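(* Let $m\ge n$, $\mathbf g\sim\mathcal{CN}(\mathbf 0,\sigma_g^2\mathbf I_m)$, $\widetilde{\mathbf b}\in\mathbb C^m$ fixed, and $$\mathcal N(\mathbf g)=\sup_{\mathbf w\in\mathbb{CS}^{n-1}}\Big|\frac1m\mathbf w^\top\mathbf R_{[1:n]}\mathbf C_{\mathbf g}^\top\operatorname{diag}(\widetilde{\mathbf b})\mathbf C_{\mathbf g}\mathbf R_{[1:n]}^\top\mathbf w\Big|.$$ Then whenever $m\ge Cn\log^4n$ for some positive constant $C$, for any integer $p\ge1$, $$\|\mathcal N(\mathbf g)\|_{L^p}\le C_{\sigma_g^2}\|\widetilde{\mathbf b}\|_\infty\Big(\sqrt{\tfrac nm}\log^{3/2}n\log^{1/2}m+\sqrt{\tfrac nm}\sqrt p+\tfrac nm p\Big),$$ where $C_{\sigma_g^2}>0$ depends only on $\sigma_g^2$.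
   Context: $\mathbb{CS}^{n-1}$ is the unit sphere of $\mathbb C^n$; $\mathbf w^\top$ is the (non-conjugate) transpose. $\mathbf g\sim\mathcal{CN}(\mathbf 0,\sigma_g^2\mathbf I_m)$: real and imaginary parts i.i.d. $\mathcal N(\mathbf 0,\tfrac{\sigma_g^2}2\mathbf I_m)$. $\mathbf C_{\mathbf g}$ is the $m\times m$ circulant matrix $(\mathbf C_{\mathbf g})_{jk}=g_{((j-k)\bmod m)+1}$; $\mathbf R_{[1:n]}^\top$ zero-pads $\mathbb C^n$ into $\mathbb C^m$. $\|X\|_{L^p}=(\mathbb E|X|^p)^{1/p}$. *)

(* Defs.v *)
From HB Require Import structures.
From mathcomp Require Import all_boot all_order all_algebra.
From mathcomp Require Import all_classical all_reals all_analysis.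
From mathcomp Require Import complex.
Set Implicit Arguments. Unset Strict Implicit. Unset Printing Implicit Defensive.
Import Order.TTheory GRing.Theory Num.Theory.
Local Open Scope classical_set_scope.
Local Open Scope ring_scope.
Local Open Scope complex_scope.

Section Defs.
Variable R : realType.

Definition cabs (z : R[i]) : R := Num.sqrt ((@complex.Re R z) ^+ 2 + (@complex.Im R z) ^+ 2).

Definition csqnorm n (w : 'cV[R[i]]_n) : R :=
  \sum_(i < n) ((@complex.Re R (w i ord0)) ^+ 2 + (@complex.Im R (w i ord0)) ^+ 2).

Definition unit_csphere n : set 'cV[R[i]]_n := [set w | csqnorm w = 1].

Definition cinfnorm m (b : 'I_m -> R[i]) : R := \big[Num.max/0]_(i < m) cabs (b i).

(* g_{k+1} for 0-based index k (0 if out of range) *)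
Definition gat m (g : 'I_m -> R[i]) (k : nat) : R[i] := oapp g 0 (insub k).

(* circulant matrix: (C_g)_{jk} = g_{((j-k) mod m)+1}, written 0-based *)
Definition circulant m (g : 'I_m -> R[i]) : 'M[R[i]]_m :=
  \matrix_(j < m, k < m) gat g ((j + m - k) %% m).

Definition zeropad m n : 'M[R[i]]_(m, n) := \matrix_(i < m, j < n) ((i : nat) == j)%:R.

Definition cdiag m (b : 'I_m -> R[i]) : 'M[R[i]]_m := diag_mx (\row_i b i).

Definition quadform m n (g b : 'I_m -> R[i]) (w : 'cV[R[i]]_n) : R[i] :=
  (m%:R)^-1 * (w^T *m (zeropad m n)^T *m (circulant g)^T *m cdiag b
                *m circulant g *m zeropad m n *m w) ord0 ord0.

Definition Nfun m n (b g : 'I_m -> R[i]) : R :=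
  sup [set x | exists2 w : 'cV[R[i]]_n, unit_csphere w & x = cabs (quadform g b w)].

Definition mutually_independent d (T : measurableType d) (I : finType)
  (P : probability T R) (Z : I -> T -> R) : Prop :=
  (forall i, measurable_fun setT (Z i)) /\
  forall B : I -> set R, (forall i, measurable (B i)) ->
    P (\bigcap_i (Z i @^-1` B i)) = (\prod_(i : I) P (Z i @^-1` B i))%E.

(* X has law N(mu, s^2) (s = standard deviation) *)
Definition has_normal_law d (T : measurableType d) (P : probability T R)
  (X : T -> R) (mu s : R) : Prop :=
  forall A : set R, measurable A -> P (X @^-1` A) = normal_prob mu s A.

(* g = X + iY ~ CN(0, sg^2 I_m): X_1..X_m, Y_1..Y_m independent, each N(0, sg^2/2) *)
Definition complex_gaussian_vector d (T : measurableType d) (P : probability T R)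
  m (X Y : 'I_m -> T -> R) (sg : R) : Prop :=
  mutually_independent P (fun s : ('I_m + 'I_m)%type =>
                            match s with inl i => X i | inr i => Y i end) /\
  (forall i, has_normal_law P (X i) 0 (Num.sqrt (sg ^+ 2 / 2))) /\
  (forall i, has_normal_law P (Y i) 0 (Num.sqrt (sg ^+ 2 / 2))).

Definition cgvec (T : Type) m (X Y : 'I_m -> T -> R) (t : T) : 'I_m -> R[i] :=
  fun i => X i t +i* Y i t.
End Defs.

(* Main.v *)
(**
  On the unit sphere [|w^T M w|] is at most the operator norm of the symmetric
  matrix [M = (1/m) W^T diag(b) W], where [W = C_g R^T] has entries
  [g_(j-k)], so [N(g)^(2q) <= tr (M M^H)^q].  As [M] is a holomorphic quadratic
  polynomial in [g], Euler's identity reads [M = (1/2) sum_s g_s G_s] with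
  [G_s = d M / d g_s], and the Gaussian integration by parts
  [E (g_s F) = sg^2 E (d F / d conj g_s)] gives
  [E tr (M M^H)^q = (sg^2/2) sum_(a < q) sum_s E tr (G_s P^a G_s^H Q^(q-1-a))]
  with [P = M^H M] and [Q = M M^H = conj P], without any decoupling.  In an eigenbasis of
  [P] this is controlled by [E tr (M M^H)^q] itself and by
  [sup_u (sum_s |G_s u|^2)^q] over unit vectors [u], whence
  [E tr (M M^H)^q <= (2 sg^2 q)^q n E sup_u (sum_s |G_s u|^2)^q].

  The supremum is replaced by a finite sum: [sum_s |G_s u|^2] involves the
  energies of correlations [sum_(k < n) h_(j+k) u_k], which a discrete Fourier
  transform of length [2 n - 1] bounds by the energies of [h] in windows of that
  length, modulated by the [2 n - 1] characters.  These are quadratic forms in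
  [g], and integration by parts bounds their moments as well.  The choice of [q]
  close to [p + ln n] absorbs the polynomial factors in [n].
*)

Require Import Defs.
From HB Require Import structures.
From mathcomp Require Import all_boot all_order all_algebra.
From mathcomp Require Import all_classical all_reals all_analysis.
From mathcomp Require Import measurable_realfun complex cyclic separable cyclotomic.
From mathcomp Require Import ring lra zify.
Set Implicit Arguments. Unset Strict Implicit. Unset Printing Implicit Defensive.
Import Order.TTheory GRing.Theory Num.Theory.
Import numFieldNormedType.Exports.
Local Open Scope classical_set_scope.
Local Open Scope ring_scope.

(** * Gaussian moments and independence *)

(** A net of the sphere would have exponentially many points in [n]. Each supremum is instead
    dominated by polynomially many terms raised to a high power: the one in [N(g)] by the [n]
    eigenvalues in a trace, the one over [u] by [(n + 1) (2 n - 1)] window energies. The resulting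
    factor, at most [4 n^3] altogether, is below a constant to the power [q] once [n <= e^q]. Both
    majorants are polynomials in [g] and its conjugate, so that every expectation reduces to
    monomials and integration by parts to the moment recursion of one real normal variable.
    Differentiating in [conj g] only leaves the holomorphic factors [M] and [G_s] untouched. The
    method yields [sqrt (n/m (p + ln n)) + n/m (p + ln n)] up to constants; the logarithmic factor
    of the statement enters only as an upper bound for [ln n] and [sqrt (ln n)]. *)

Section Density.
Local Open Scope ereal_scope.
Import HBNNSimple.

(** The hypothesis says that [nu] is the image under [phi] of the measure of density [W]. The case
    [phi = id] serves the normal density, the case [phi = Z j] the weighted laws of the independence
    argument. *)
Lemma ge0_integral_density d d' (T : measurableType d) (U : measurableType d')
    (R : realType) (mu : {measure set T -> \bar R}) (nu : {measure set U -> \bar R})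
    (phi : T -> U) (W : T -> R) (f : U -> R) :
  measurable_fun setT phi -> measurable_fun setT W -> (forall x, (0 <= W x)%R) ->
  (forall B, measurable B -> nu B = \int[mu]_(x in phi @^-1` B) (W x)%:E) ->
  measurable_fun setT f -> (forall y, (0 <= f y)%R) ->
  \int[nu]_y (f y)%:E = \int[mu]_x (f (phi x) * W x)%:E.
Proof.
move=> mphi mW W0 nuE mf f0.
have mf' := (measurable_EFinP _ _).2 mf.
pose h := nnsfun_approx measurableT mf'.
have hf y : (EFin \o h n) y @[n --> \oo] --> (f y)%:E.
  by apply: cvg_nnsfun_approx => // x _; rewrite /= lee_fin.
have -> : \int[nu]_y (f y)%:E = lim (\int[nu]_y (h n y)%:E @[n --> \oo]).
  under eq_integral => y _ do rewrite -(cvg_lim _ (hf y))//.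
  apply: monotone_convergence => //.
  - by move=> n; exact/measurable_EFinP.
  - by move=> n x _ /=; rewrite lee_fin.
  - by move=> x _ a b ab; rewrite lee_fin; exact/lefP/nd_nnsfun_approx.
have mhW n : measurable_fun setT (fun x => (h n (phi x) * W x)%:E).
  apply/measurable_EFinP; apply: measurable_funM => //.
  exact: measurableT_comp.
have -> : \int[mu]_x (f (phi x) * W x)%:E =
    lim (\int[mu]_x (h n (phi x) * W x)%:E @[n --> \oo]).
  have fg x : (h n (phi x) * W x)%:E @[n --> \oo] --> (f (phi x) * W x)%:E.
    under eq_fun do rewrite EFinM.
    by rewrite EFinM; apply: cvgeZr => //; apply: hf.
  under eq_integral => y _ do rewrite -(cvg_lim _ (fg y))//.
  apply: (monotone_convergence mu measurableT mhW) => //.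
  - by move=> n x _ /=; rewrite lee_fin mulr_ge0.
  - move=> x _ a b ab; rewrite lee_fin ler_wpM2r//.
    by exact/lefP/nd_nnsfun_approx.
suff suf n : \int[nu]_y (h n y)%:E = \int[mu]_x (h n (phi x) * W x)%:E.
  by under eq_fun do rewrite suf.
transitivity (\int[nu]_x (\sum_(y \in range (h n)) (y * \1_(h n @^-1` [set y]) x)%:E)).
  by apply: eq_integral => t tE; rewrite /= fimfunE -fsumEFin.
have indich r : measurable_fun setT (fun x => (r * \1_(h n @^-1` [set r]) x)%:E).
  by apply/measurable_EFinP; exact: measurable_funM.
rewrite ge0_integral_fsum//; last by move=> m y Ey; exact: nnfun_muleindic_ge0.
transitivity (\int[mu]_x (\sum_(y \in range (h n))
    (y * \1_(h n @^-1` [set y]) (phi x) * W x)%:E)); last first.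
  apply: eq_integral => x xE.
  rewrite fsumEFin//; congr EFin.
  by rewrite [in RHS](fimfunE (h n)) mulr_fsuml.
rewrite ge0_integral_fsum//; last 2 first.
  - move=> y; apply/measurable_EFinP; apply: measurable_funM => //.
    apply: measurable_funM => //.
    apply: (measurableT_comp _ mphi) => //.
  - move=> m y Ey; rewrite EFinM mule_ge0 ?lee_fin ?W0//.
    by rewrite -lee_fin EFinM nnfun_muleindic_ge0.
apply: eq_fsbigr => r; rewrite inE => -[z _ zr].
have r0 : (0 <= r)%R by rewrite -zr.
under eq_integral do rewrite EFinM.
rewrite ge0_integralZl_EFin//; last first.
  by apply/measurable_EFinP.
under [RHS]eq_integral do rewrite -mulrA EFinM.
have mi : measurable (h n @^-1` [set r]) by [].
rewrite ge0_integralZl_EFin//; last 2 first.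
- by move=> *; rewrite lee_fin mulr_ge0.
- apply/measurable_EFinP; apply: measurable_funM => //.
  by apply: (measurableT_comp _ mphi) => //.
congr (_ * _); rewrite integral_indic// setIT nuE// integral_mkcond.
apply: eq_integral => x _; rewrite patchE indicE /=.
have -> : (x \in phi @^-1` (h n @^-1` [set r])) = (phi x \in h n @^-1` [set r]).
  by apply/idP/idP; rewrite !inE.
by case: (_ \in _) => /=; rewrite ?mul1r ?mul0r.
Qed.

End Density.

Section DensitySigned.
Context d d' (T : measurableType d) (U : measurableType d') (R : realType).
Variables (mu : {measure set T -> \bar R}) (nu : {measure set U -> \bar R}).
Variables (phi : T -> U) (W : T -> R) (f : U -> R).
Hypothesis mphi : measurable_fun setT phi.
Hypothesis mW : measurable_fun setT W.
Hypothesis W0 : forall x, 0 <= W x.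
Hypothesis nuE : forall B, measurable B ->
  nu B = (\int[mu]_(x in phi @^-1` B) (W x)%:E)%E.
Hypothesis mf : measurable_fun setT f.

Lemma integrable_density : nu.-integrable setT (EFin \o f) <->
  mu.-integrable setT (EFin \o (fun x => f (phi x) * W x)).
Proof.
have mfn : measurable_fun setT (fun y => `|f y|) by exact: measurableT_comp.
have E := ge0_integral_density mphi mW W0 nuE mfn (fun y => normr_ge0 _).
have EE : (\int[nu]_y `|(EFin \o f) y| = \int[mu]_x `|(f (phi x) * W x)%:E|)%E.
  transitivity (\int[nu]_y (`|f y|)%:E)%E; first by [].
  rewrite E; apply: eq_integral => x _.
  by rewrite /= normrM (ger0_norm (W0 x)).
split=> /integrableP[_ I]; apply/integrableP; split.
- apply/measurable_EFinP; apply: measurable_funM => //.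
  exact: (measurableT_comp mf).
- by rewrite -EE.
- exact/measurable_EFinP.
- by rewrite EE.
Qed.

Lemma integral_density : mu.-integrable setT (EFin \o (fun x => f (phi x) * W x)) ->
  (\int[nu]_y (f y)%:E = \int[mu]_x (f (phi x) * W x)%:E)%E.
Proof.
move=> I; rewrite [LHS]integralE [RHS]integralE.
have mp : measurable_fun setT (f^\+)%R by exact: measurable_funrpos.
have mn : measurable_fun setT (f^\-)%R by exact: measurable_funrneg.
have Ep := ge0_integral_density mphi mW W0 nuE mp (funrpos_ge0 f).
have En := ge0_integral_density mphi mW W0 nuE mn (funrneg_ge0 f).
congr (_ - _)%E.
- transitivity (\int[nu]_y (f^\+%R y)%:E)%E.
    by apply: eq_integral => x _; rewrite funerpos.
  rewrite Ep; apply: eq_integral => x _.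
  rewrite funeposE/= -EFin_max /funrpos; congr EFin.
  by rewrite maxr_pMl ?mul0r.
- transitivity (\int[nu]_y (f^\-%R y)%:E)%E.
    by apply: eq_integral => x _; rewrite funerneg.
  rewrite En; apply: eq_integral => x _.
  rewrite funenegE/= -EFin_max /funrneg; congr EFin.
  by rewrite maxr_pMl ?mul0r// mulNr.
Qed.

End DensitySigned.

Section GaussianMoments.
Variable R : realType.
Implicit Types (c s x : R) (k : nat).
Notation mu := (@lebesgue_measure R).

(** Outside [[-1, 1]], one term of the exponential series gives
    [(c x^2)^(k+1) <= (k+1)! exp (c x^2)], and [|x|^k <= |x|^(2 (k+1))]. *)
Lemma pow_expR_bound c k : 0 < c ->
  exists C, forall x, `|x| ^+ k * expR (- (c * x ^+ 2)) <= C.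
Proof.
move=> c0; exists (1 + (k.+1)`!%:R / c ^+ k.+1) => x.
have e1 : expR (- (c * x ^+ 2)) <= 1.
  by rewrite expR_le1 oppr_le0 mulr_ge0 ?sqr_ge0 ?ltW.
have [x1|x1] := leP `|x| 1.
  apply: (@le_trans _ _ 1).
    by rewrite mulr_ile1 ?exprn_ge0 ?expR_ge0 ?exprn_ile1.
  by rewrite lerDl divr_ge0 ?exprn_ge0 ?ltW.
apply: (@le_trans _ _ ((k.+1)`!%:R / c ^+ k.+1)); last by rewrite lerDr.
rewrite ler_pdivlMr ?exprn_gt0// expRN -mulrA mulrCA.
rewrite ler_pdivrMl ?expR_gt0//.
have y0 : 0 <= c * x ^+ 2 by rewrite mulr_ge0 ?sqr_ge0 ?ltW.
have := expR_ge1Dxn k y0.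
rewrite -ler_pdivrMr ?ltr0n ?fact_gt0//; apply: le_trans.
apply: (@le_trans _ _ ((c * x ^+ 2) ^+ k.+1 / (k.+1)`!%:R)); last by rewrite lerDr.
rewrite ler_pM2r ?invr_gt0 ?ltr0n ?fact_gt0//.
rewrite exprMn mulrC ler_wpM2l ?exprn_ge0 ?(ltW c0)//.
rewrite -real_normK ?num_real// -exprM; apply: ler_weXn2l; first exact: ltW.
by rewrite mul2n -addnn; apply: leq_trans (leq_addr _ _).
Qed.

Definition gauss_kernel c x := expR (- (c * x ^+ 2)).

Lemma is_derive_gauss_pow c k x :
  is_derive x 1 (fun x => x ^+ k * gauss_kernel c x)
    ((k%:R * x ^+ k.-1 - 2 * c * x ^+ k.+1) * gauss_kernel c x).
Proof.
have d1 : is_derive x 1 (fun x => - (c * x ^+ 2)) (- (c * (2 * x))).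
  by apply: is_derive_eq; rewrite /GRing.scale /=; ring.
have d2 : is_derive x 1 (gauss_kernel c) ((- (c * (2 * x))) * gauss_kernel c x).
  rewrite mulrC. apply: is_derive1_comp.
have d3 : is_derive x 1 (fun x => x ^+ k) (k%:R * x ^+ k.-1).
  have := @is_deriveX R R id k x 1 1 (is_derive_id x 1).
  by rewrite fctE /GRing.scale /= mulr1.
by apply: is_derive_eq; rewrite /GRing.scale /= exprS; ring.
Qed.

Lemma measurable_gauss_pow c k :
  measurable_fun setT (fun x : R => x ^+ k * gauss_kernel c x).
Proof.
apply: measurable_funM; first exact: measurable_funX.
apply: measurableT_comp => //; apply: measurableT_comp => //.
by apply: measurable_funM => //; exact: measurable_funX.
Qed.

Lemma integrable_gauss_kernel c : 0 < c ->
  mu.-integrable setT (EFin \o gauss_kernel c).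
Proof.
move=> c0; pose s := Num.sqrt (2 * c)^-1.
have s2 : s ^+ 2 = (2 * c)^-1 by rewrite sqr_sqrtr// invr_ge0 mulr_ge0// ltW.
have s0 : s != 0.
  by rewrite gt_eqF// sqrtr_gt0 invr_gt0 mulr_gt0.
have := integrableZl measurableT (normal_peak s)^-1 (integrable_normal_pdf 0 s).
apply: eq_integrable => // x _.
rewrite /= -EFinM normal_pdfE// mulKf ?gt_eqF ?normal_peak_gt0//.
rewrite /normal_fun/gauss_kernel s2 subr0; congr ((expR _)%:E).
by field; rewrite gt_eqF.
Qed.

Lemma integrable_gauss_pow c k : 0 < c ->
  mu.-integrable setT (EFin \o (fun x : R => x ^+ k * gauss_kernel c x)).
Proof.
move=> c0; have c20 : 0 < c / 2 by rewrite divr_gt0.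
have [C HC] := pow_expR_bound k c20.
have := integrableZl measurableT C (integrable_gauss_kernel c20).
apply: le_integrable => //; first by apply/measurable_EFinP; exact: measurable_gauss_pow.
move=> x _ /=; rewrite lee_fin.
rewrite normrM normrX [`|gauss_kernel c x|]ger0_norm ?expR_ge0//.
apply: le_trans (ler_norm _).
(* Half of the exponent absorbs the power, the other half stays integrable. *)
have -> : gauss_kernel c x = gauss_kernel (c / 2) x * gauss_kernel (c / 2) x.
  by rewrite /gauss_kernel -expRD; congr expR; field.
by rewrite mulrA ler_wpM2r ?expR_ge0// HC.
Qed.

(** The fundamental theorem of calculus on [[-(n+1), n+1]], then dominated convergence with [|f|]
    itself as the dominating function. *)
Lemma integral_derive_eq0 (F f : R -> R) :
  (forall x : R, is_derive x 1 F (f x)) -> continuous f ->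
  mu.-integrable setT (EFin \o f) ->
  F n.+1%:R @[n --> \oo] --> 0 -> F (- n.+1%:R) @[n --> \oo] --> 0 ->
  (\int[mu]_x (f x)%:E = 0)%E.
Proof.
move=> dF cf intf F1 F2.
pose D n : set R := `[- n.+1%:R, n.+1%:R]%classic.
have cF : continuous F.
  move=> x; apply: differentiable_continuous; apply/derivable1_diffP.
  by have [] := dF x.
have fE n : (\int[mu]_x ((EFin \o f) \_ (D n)) x = (F n.+1%:R - F (- n.+1%:R))%:E)%E.
  rewrite -integral_mkcond (@continuous_FTC2 _ f F)//.
  - by rewrite gtrN.
  - exact: continuous_subspaceT.
  - split.
    + by move=> x _; by have [] := dF x.
    + by apply: cvg_at_right_filter; exact: cF.
    + by apply: cvg_at_left_filter; exact: cF.
  - by move=> x _; rewrite derive1E; by have [] := dF x.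
have mf := measurable_int _ intf.
have [_ _ cv] : [/\ mu.-integrable setT (EFin \o f),
  [sequence \int[mu]_x `|((EFin \o f) \_ (D n)) x - (EFin \o f) x|%E]_n @ \oo --> 0%E &
  [sequence \int[mu]_x ((EFin \o f) \_ (D n)) x]_n @ \oo --> \int[mu]_x (EFin \o f) x]%E.
  apply: (@dominated_convergence _ _ _ mu _ measurableT _ _ (abse \o (EFin \o f))) => //.
  - move=> n; apply: (measurable_restrictT _ _).1; first exact: measurable_itv.
    exact: measurable_funTS.
  - apply: aeW => x _; apply: (@cvg_near_cst _ _ _ _ \oo).
    near=> n; rewrite patchE /D mem_set//= in_itv/= -ler_norml.
    rewrite (@le_trans _ _ n%:R) ?ler_nat//.
    by near: n; exact: nbhs_infty_ger.
  - exact: integrable_abse.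
  - apply: aeW => x n _; rewrite /= patchE; case: ifP => // _.
    by rewrite abse0.
apply: (cvg_unique _ cv) => //.
rewrite (_ : [sequence _]_n = (fun n => (F n.+1%:R - F (- n.+1%:R))%:E)); last first.
  by apply/funext => n; exact: fE.
apply: cvg_EFin; first exact: nearW.
by have := cvgB F1 F2; rewrite subr0; apply.
Unshelve. all: by end_near. Qed.

(** The sign [e] treats both ends at once; the bound for the power [k + 1] leaves a factor
    [1 / (n+1)]. *)
Lemma cvg_gauss_pow c k (e : R) : 0 < c -> e ^+ 2 = 1 ->
  (e * n.+1%:R) ^+ k * gauss_kernel c (e * n.+1%:R) @[n --> \oo] --> 0.
Proof.
move=> c0 e1; have [C HC] := pow_expR_bound k.+1 c0.
have ne : `|e| = 1 by rewrite -[RHS]sqrtr1 -e1 sqrtr_sqr.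
apply/cvgr0Pnorm_lt => eps eps0; near=> n.
have n0 : 0 < n.+1%:R :> R by rewrite ltr0n.
rewrite normrM [`|gauss_kernel _ _|]ger0_norm ?expR_ge0//.
have := HC (e * n.+1%:R); rewrite exprS -mulrA normrM ne mul1r normrX ger0_norm//.
rewrite normrM ne mul1r ger0_norm// => H.
have -> : n.+1%:R ^+ k * gauss_kernel c (e * n.+1%:R) =
    n.+1%:R^-1 * (n.+1%:R * (n.+1%:R ^+ k * gauss_kernel c (e * n.+1%:R))).
  by rewrite mulKf ?gt_eqF.
apply: (@le_lt_trans _ _ (n.+1%:R^-1 * C)).
  by rewrite ler_wpM2l ?invr_ge0.
rewrite mulrC ltr_pdivrMr// -ltr_pdivrMl// mulrC.
rewrite (@lt_trans _ _ n%:R) ?ltr_nat//.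
by near: n; exact: nbhs_infty_gtr.
Unshelve. all: by end_near. Qed.

(** The derivative of [x^k exp (-c x^2)] integrates to zero. For [k = 0] the truncated [k.-1] comes
    with the coefficient 0, and the identity says that the first moment vanishes. *)
Lemma gauss_pow_IBP c k : 0 < c ->
  \int[mu]_x (x ^+ k.+1 * gauss_kernel c x) =
  k%:R / (2 * c) * \int[mu]_x (x ^+ k.-1 * gauss_kernel c x).
Proof.
move=> c0.
pose f (x : R) := (k%:R * x ^+ k.-1 - 2 * c * x ^+ k.+1) * gauss_kernel c x.
have fE x : f x = k%:R * (x ^+ k.-1 * gauss_kernel c x) -
    2 * c * (x ^+ k.+1 * gauss_kernel c x) by rewrite /f; ring.
have I j a : mu.-integrable setT (EFin \o (fun x : R => a * (x ^+ j * gauss_kernel c x))).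
  have := integrableZl measurableT a (integrable_gauss_pow j c0).
  by apply: eq_integrable => // x _; rewrite /= -EFinM.
have intf : mu.-integrable setT (EFin \o f).
  have := integrableB measurableT (I k.-1 k%:R) (I k.+1 (2 * c)).
  by apply: eq_integrable => // x _; rewrite /= fE EFinB.
have cf : continuous f.
  move=> x; apply: differentiable_continuous; apply/derivable1_diffP.
  have H j := @ex_derive _ _ _ _ _ _ _ (is_derive_gauss_pow c j x).
  rewrite (_ : f = (cst k%:R * (fun x => x ^+ k.-1 * gauss_kernel c x)) -
    (cst (2 * c) * (fun x => x ^+ k.+1 * gauss_kernel c x))); last first.
    by apply/funext => y; rewrite fE.
  by apply: derivableB; apply: derivableM => //; exact: H.
have Z := integral_derive_eq0 (is_derive_gauss_pow c k) cf intf.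
have {Z} : (\int[mu]_x (f x)%:E = 0)%E.
  apply: Z.
  - by have := cvg_gauss_pow k c0 (expr1n R 2); under eq_fun do rewrite mul1r.
  - have e1 : (-1) ^+ 2 = 1 :> R by rewrite sqrrN expr1n.
    by have := cvg_gauss_pow k c0 e1; under eq_fun do rewrite mulN1r.
move=> Z; have : \int[mu]_x f x = 0 by rewrite /Rintegral Z.
under eq_Rintegral do rewrite fE.
rewrite RintegralB//.
rewrite !RintegralZl ?(integrable_gauss_pow _ c0)//.
move/eqP; rewrite subr_eq0 => /eqP E.
by rewrite mulrAC E mulrC mulrA mulVf ?mul1r// gt_eqF// mulr_gt0.
Qed.

Definition normal_moment s k : R := \int[normal_prob 0 s]_x (x ^+ k).

Lemma normal_pdf_kernel s x : s != 0 ->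
  normal_pdf 0 s x = normal_peak s * gauss_kernel (2 * s ^+ 2)^-1 x.
Proof.
move=> s0; rewrite normal_pdfE// /normal_fun /gauss_kernel subr0.
by congr (_ * expR _); field.
Qed.

Lemma integrable_pow_pdf s k : s != 0 ->
  mu.-integrable setT (EFin \o (fun x => x ^+ k * normal_pdf 0 s x)).
Proof.
move=> s0; have c0 : 0 < (2 * s ^+ 2)^-1.
  by rewrite invr_gt0 mulr_gt0// exprn_even_gt0.
have := integrableZl measurableT (normal_peak s) (integrable_gauss_pow k c0).
apply: eq_integrable => // x _.
by rewrite /= normal_pdf_kernel// -EFinM mulrCA.
Qed.

Lemma integrable_normal_pow s k : s != 0 ->
  (normal_prob 0 s).-integrable setT (EFin \o (fun x : R => x ^+ k)).
Proof.
move=> s0; apply/(integrable_density (mu := mu) (phi := id) (W := normal_pdf 0 s)) => //.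
- exact: measurable_normal_pdf.
- by move=> x; exact: normal_pdf_ge0.
- exact: integrable_pow_pdf.
Qed.

Lemma normal_momentE s k : s != 0 -> normal_moment s k =
  normal_peak s * \int[mu]_x (x ^+ k * gauss_kernel (2 * s ^+ 2)^-1 x).
Proof.
move=> s0; have c0 : 0 < (2 * s ^+ 2)^-1.
  by rewrite invr_gt0 mulr_gt0// exprn_even_gt0.
rewrite -RintegralZl ?(integrable_gauss_pow _ c0)//.
rewrite /normal_moment /Rintegral.
rewrite (integral_density (mu := mu) (phi := id) (W := normal_pdf 0 s)) //.
- by congr fine; apply: eq_integral => x _; rewrite normal_pdf_kernel// mulrCA.
- exact: measurable_normal_pdf.
- by move=> x; exact: normal_pdf_ge0.
- exact: integrable_pow_pdf.
Qed.

Lemma normal_momentS s k : s != 0 ->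
  normal_moment s k.+1 = s ^+ 2 * k%:R * normal_moment s k.-1.
Proof.
move=> s0; have c0 : 0 < (2 * s ^+ 2)^-1.
  by rewrite invr_gt0 mulr_gt0// exprn_even_gt0.
rewrite !normal_momentE// gauss_pow_IBP// invfM invrK.
by field.
Qed.

End GaussianMoments.

Section Independence.
Context d (T : measurableType d) (R : realType) (P : probability T R).
Context (I : finType) (Z : I -> T -> R) (nu : probability (measurableTypeR R) R).
Hypothesis indep : mutually_independent P Z.
Hypothesis law : forall i A, measurable A -> P (Z i @^-1` A) = nu A.
Implicit Type f : I -> R -> R.

Let mZ i : measurable_fun setT (Z i). Proof. by case: indep. Qed.

Lemma measurable_prod_comp f : (forall i, measurable_fun setT (f i)) ->
  forall Q : pred I, measurable_fun setT (fun t => \prod_(i | Q i) f i (Z i t)).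
Proof.
move=> mf Q; under eq_fun do rewrite -big_filter.
apply: measurable_prod => i _.
exact: (measurableT_comp (mf i) (mZ i)).
Qed.

Lemma EFin_Rintegral (f : R -> R) : nu.-integrable setT (EFin \o f) ->
  (\int[nu]_x (f x)%:E)%E = (\int[nu]_x f x)%:E.
Proof. by move=> If; rewrite /Rintegral fineK//; exact: integrable_fin_num If. Qed.

Lemma integral_nu_indic (B : set R) : measurable B ->
  (\int[nu]_x (\1_B x)%:E)%E = nu B.
Proof. by move=> mB; rewrite integral_indic//; congr (nu _); exact: setIT. Qed.

Lemma integrable_nu_indic (B : set R) : measurable B ->
  nu.-integrable setT (EFin \o \1_B).
Proof. by move=> mB; apply: integrable_indic. Qed.

(* Induction on the list of indices at which [f] is not an indicator function:
   such an [f j] is integrated against the law of [Z j] under the measure of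
   density [prod_(i != j) f i (Z i)], which the induction hypothesis identifies. *)
Lemma ge0_integral_prod f (s : seq I) :
  (forall i, measurable_fun setT (f i)) -> (forall i x, 0 <= f i x) ->
  (forall i, nu.-integrable setT (EFin \o f i)) ->
  (forall i, i \notin s -> exists2 B : set R, measurable B & f i = \1_B) ->
  (\int[P]_t (\prod_i f i (Z i t))%:E)%E = (\prod_i \int[nu]_x f i x)%:E.
Proof.
elim: s f => [|j s IH] f mf f0 If fB.
  have /choice[B HB] : forall i, exists B : set R, measurable B /\ f i = \1_B.
    by move=> i; have [//|B ? ?] := fB i; exists B.
  have E t : \prod_i f i (Z i t) = \1_(\bigcap_i (Z i @^-1` B i)) t.
    rewrite indicE; have [tB|tB] := boolP (t \in _).
      rewrite big1// => i _; rewrite (HB i).2 indicE mem_set//.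
      by move: tB; rewrite inE => /(_ i); apply.
    have /existsNP[i Hi] : ~ forall i, B i (Z i t).
      by move=> H; move/negP: tB; apply; rewrite inE => i _; exact: H.
    by rewrite (bigD1 i)//= (HB i).2 indicE memNset// mul0r.
  under eq_integral do rewrite E.
  have mB : forall i, measurable (B i) by move=> i; exact: (HB i).1.
  rewrite integral_indic//; last first.
    apply: fin_bigcap_measurable => // i _.
    by rewrite -[X in measurable X]setTI; exact: mZ.
  rewrite setIT -prodEFin; apply: (etrans (indep.2 B mB)); apply: eq_bigr => i _.
  rewrite -EFin_Rintegral// (HB i).2.
  by rewrite integral_nu_indic//; exact: law.
pose W t := \prod_(i | i != j) f i (Z i t).
pose c := \prod_(i | i != j) \int[nu]_x f i x.
have c0 : 0 <= c.
  by apply: prodr_ge0 => i _; apply: Rintegral_ge0 => x _; exact: f0.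
have mW : measurable_fun setT W by exact: measurable_prod_comp.
have W0 t : 0 <= W t by apply: prodr_ge0 => i _; exact: f0.
have nuE B : measurable B -> mscale (NngNum c0) nu B = (\int[P]_(x in Z j @^-1` B) (W x)%:E)%E.
  move=> mB; pose g i := if i == j then \1_B else f i.
  have gE t : \prod_i g i (Z i t) = \1_(Z j @^-1` B) t * W t.
    rewrite (bigD1 j)//= /g eqxx !indicE; congr (_ * _).
    by apply: eq_bigr => i /negbTE ->.
  have cE : \prod_i \int[nu]_x g i x = (\int[nu]_x (\1_B x : R)) * c.
    rewrite (bigD1 j)//= {1}/g eqxx; congr (_ * _).
    by apply: eq_bigr => i /negbTE ij; rewrite /g ij.
  rewrite /mscale/=.
  transitivity (\int[P]_t (\prod_i g i (Z i t))%:E)%E.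
    rewrite IH ?cE ?EFinM 1?muleC.
    - congr (_ * _)%E; rewrite -EFin_Rintegral ?integral_nu_indic//.
      exact: integrable_nu_indic.
    - by move=> i; rewrite /g; case: ifP.
    - by move=> i x; rewrite /g; case: ifP.
    - by move=> i; rewrite /g; case: ifP => // _; exact: integrable_nu_indic.
    - move=> i si; rewrite /g; have [ij|ij] := eqVneq i j; first by exists B.
      by apply: fB; rewrite inE negb_or ij.
  rewrite [RHS]integral_mkcond; apply: eq_integral => t _.
  rewrite gE patchE indicE; case: (_ \in _); by rewrite ?mul1r ?mul0r.
transitivity (\int[P]_t (f j (Z j t) * W t)%:E)%E.
  by apply: eq_integral => t _; rewrite (bigD1 j).
rewrite -(@ge0_integral_density _ _ _ (measurableTypeR R) _ _ (mscale (NngNum c0) nu) _ _ _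
  (mZ j) mW W0 nuE (mf j) (f0 j)).
have mfE := (measurable_EFinP _ _).2 (mf j).
rewrite ge0_integral_mscale//; last by move=> x _; rewrite lee_fin.
by rewrite EFin_Rintegral// -EFinM mulrC [in RHS](bigD1 j).
Qed.

Lemma integrable_prod f : (forall i, measurable_fun setT (f i)) ->
  (forall i, nu.-integrable setT (EFin \o f i)) ->
  P.-integrable setT (EFin \o (fun t => \prod_i f i (Z i t))).
Proof.
move=> mf If; apply/integrableP; split.
  by apply/measurable_EFinP; exact: measurable_prod_comp.
have E := @ge0_integral_prod (fun i x => `|f i x|) (enum I).
rewrite [X in (X < _)%E](_ : _ = (\int[P]_t (\prod_i `|f i (Z i t)|)%:E)%E); last first.
  by apply: eq_integral => t _; rewrite /= normr_prod.
rewrite E ?ltry//.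
- by move=> i; exact: measurableT_comp.
- by move=> i; exact: integrable_norm.
- by move=> i; rewrite mem_enum.
Qed.

(** A second induction, on the indices where [f] may change sign: there [f j] is split into its
    positive and negative parts, to which the induction hypothesis applies. *)
Lemma Rintegral_prod f (s : seq I) : (forall i, measurable_fun setT (f i)) ->
  (forall i, nu.-integrable setT (EFin \o f i)) ->
  (forall i, i \notin s -> forall x, 0 <= f i x) ->
  \int[P]_t (\prod_i f i (Z i t)) = \prod_i \int[nu]_x f i x.
Proof.
elim: s f => [|j s IH] f mf If f0.
  rewrite {1}/Rintegral (@ge0_integral_prod _ (enum I))//.
  - by move=> i x; exact: f0.
  - by move=> i; rewrite mem_enum.
pose g (h : R -> R) i := if i == j then h else f i.
have gE h t : \prod_i g h i (Z i t) = h (Z j t) * \prod_(i | i != j) f i (Z i t).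
  rewrite (bigD1 j)//= {1}/g eqxx; congr (_ * _).
  by apply: eq_bigr => i /negbTE ij; rewrite /g ij.
have gI h : \prod_i \int[nu]_x g h i x = (\int[nu]_x h x) * \prod_(i | i != j) \int[nu]_x f i x.
  rewrite (bigD1 j)//= {1}/g eqxx; congr (_ * _).
  by apply: eq_bigr => i /negbTE ij; rewrite /g ij.
have key h : measurable_fun setT h -> nu.-integrable setT (EFin \o h) -> (forall x, 0 <= h x) ->
  P.-integrable setT (EFin \o (fun t => h (Z j t) * \prod_(i | i != j) f i (Z i t))) /\
  \int[P]_t (h (Z j t) * \prod_(i | i != j) f i (Z i t)) =
    (\int[nu]_x h x) * \prod_(i | i != j) \int[nu]_x f i x.
  move=> mh Ih h0.
  have mg i : measurable_fun setT (g h i) by rewrite /g; case: ifP.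
  have Ig i : nu.-integrable setT (EFin \o g h i) by rewrite /g; case: ifP.
  split.
    have := integrable_prod mg Ig; apply: eq_integrable => // t _.
    by rewrite /= gE.
  rewrite -gI -(IH (g h))//.
    by apply: eq_Rintegral => t _; rewrite gE.
  move=> i si x; rewrite /g; have [//|ij] := eqVneq i j.
  by apply: f0; rewrite inE negb_or ij.
have Ip : nu.-integrable setT (EFin \o (f j)^\+) by exact: integrable_funrpos.
have In : nu.-integrable setT (EFin \o (f j)^\-) by exact: integrable_funrneg.
have [I1 E1] := key _ (measurable_funrpos (mf j)) Ip (funrpos_ge0 _).
have [I2 E2] := key _ (measurable_funrneg (mf j)) In (funrneg_ge0 _).
transitivity (\int[P]_t ((f j)^\+ (Z j t) * \prod_(i | i != j) f i (Z i t) -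
    (f j)^\- (Z j t) * \prod_(i | i != j) f i (Z i t))).
  apply: eq_Rintegral => t _; rewrite (bigD1 j)//= -mulrBl; congr (_ * _).
  by rewrite -[in LHS](funrposBneg (f j)).
rewrite RintegralB// E1 E2 -mulrBl -RintegralB// [RHS](bigD1 j)//=; congr (_ * _).
by apply: eq_Rintegral => x _; rewrite -[in RHS](funrposBneg (f j)).
Qed.

End Independence.

(** * Integration by parts for polynomials in complex Gaussian variables *)

Section ComplexExpectation.
Local Open Scope complex_scope.
Context d (T : measurableType d) (R : realType) (P : probability T R).
Implicit Types (F G : T -> R[i]) (c : R[i]).
Notation Rez := (@complex.Re R).
Notation Imz := (@complex.Im R).

Definition cE F : R[i] :=
  (\int[P]_t (Rez (F t))) +i* (\int[P]_t (Imz (F t))).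

Definition cint F := P.-integrable setT (EFin \o (fun t => Rez (F t))) /\
  P.-integrable setT (EFin \o (fun t => Imz (F t))).

Lemma RezD (x y : R[i]) : Rez (x + y) = Rez x + Rez y.
Proof. by case: x y => [? ?] [? ?]. Qed.

Lemma ImzD (x y : R[i]) : Imz (x + y) = Imz x + Imz y.
Proof. by case: x y => [? ?] [? ?]. Qed.

Lemma RezM (x y : R[i]) : Rez (x * y) = Rez x * Rez y - Imz x * Imz y.
Proof. by case: x y => [? ?] [? ?]. Qed.

Lemma ImzM (x y : R[i]) : Imz (x * y) = Rez x * Imz y + Imz x * Rez y.
Proof. by case: x y => [? ?] [? ?]. Qed.

Lemma complex_eq (x y : R[i]) : Rez x = Rez y -> Imz x = Imz y -> x = y.
Proof. by case: x y => [? ?] [? ?] /= -> ->. Qed.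

Lemma eq_cE F G : F =1 G -> cE F = cE G.
Proof. by move=> /funext ->. Qed.

Lemma cintD F G : cint F -> cint G -> cint (fun t => F t + G t).
Proof.
move=> [F1 F2] [G1 G2]; split.
- have := integrableD measurableT F1 G1; apply: eq_integrable => // t _.
  by rewrite /= RezD.
- have := integrableD measurableT F2 G2; apply: eq_integrable => // t _.
  by rewrite /= ImzD.
Qed.

Lemma cED F G : cint F -> cint G -> cE (fun t => F t + G t) = cE F + cE G.
Proof.
move=> [F1 F2] [G1 G2]; apply: complex_eq => /=.
  by rewrite -RintegralD//; apply: eq_Rintegral => t _; rewrite RezD.
by rewrite -RintegralD//; apply: eq_Rintegral => t _; rewrite ImzD.
Qed.

Lemma integrable_lin (f g : T -> R) (a b : R) :
  P.-integrable setT (EFin \o f) -> P.-integrable setT (EFin \o g) ->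
  P.-integrable setT (EFin \o (fun t => a * f t + b * g t)).
Proof.
move=> If Ig.
have := integrableD measurableT (integrableZl measurableT a If) (integrableZl measurableT b Ig).
by apply: eq_integrable => // t _; rewrite /= -!EFinM -EFinD.
Qed.

Lemma Rintegral_lin (f g : T -> R) (a b : R) :
  P.-integrable setT (EFin \o f) -> P.-integrable setT (EFin \o g) ->
  \int[P]_t (a * f t + b * g t) = a * \int[P]_t f t + b * \int[P]_t g t.
Proof.
move=> If Ig; rewrite RintegralD ?RintegralZl//.
- have := integrableZl measurableT a If; apply: eq_integrable => // t _.
- have := integrableZl measurableT b Ig; apply: eq_integrable => // t _.
Qed.

Lemma cintZ c F : cint F -> cint (fun t => c * F t).
Proof.
move=> [F1 F2]; split.
- have := integrable_lin (Rez c) (- Imz c) F1 F2; apply: eq_integrable => // t _.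
  by rewrite /= RezM mulNr.
- have := integrable_lin (Rez c) (Imz c) F2 F1; apply: eq_integrable => // t _.
  by rewrite /= ImzM.
Qed.

Lemma cEZ c F : cint F -> cE (fun t => c * F t) = c * cE F.
Proof.
move=> [F1 F2]; apply: complex_eq; rewrite ?RezM ?ImzM /=.
  rewrite -mulNr -Rintegral_lin//.
  by apply: eq_Rintegral => t _; rewrite RezM mulNr.
by rewrite -Rintegral_lin//; apply: eq_Rintegral => t _; rewrite ImzM.
Qed.

Lemma cint_real (f : T -> R) : P.-integrable setT (EFin \o f) -> cint (fun t => (f t)%:C).
Proof. by move=> If; split => //=; exact: integrable0. Qed.

Lemma cE_real (f : T -> R) : cE (fun t => (f t)%:C) = (\int[P]_t f t)%:C.
Proof.
apply: complex_eq => //=.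
by rewrite Rintegral_cst// mul0r.
Qed.

End ComplexExpectation.

Section PolynomialVariables.
Local Open Scope complex_scope.
Context d (T : measurableType d) (R : realType) (P : probability T R).
Context (I : finType) (Z : I -> T -> R) (s : R).
Hypothesis s_neq0 : s != 0.
Hypothesis indep : mutually_independent P Z.
Hypothesis law : forall i, has_normal_law P (Z i) 0 s.
Implicit Types (F G : T -> R[i]) (D : I -> T -> R[i]) (k : I -> nat).

Definition zmono k t : R := \prod_i Z i t ^+ k i.

(** The subtraction truncates when [k i = 0]; in [poly_grad_mono] the coefficient [k i] then kills
    the term. *)
Definition kdecr k i : I -> nat := fun j => (k j - (i == j))%N.

(* [poly_grad F D]: [F] is a polynomial in the variables [Z], and [D i] is its
   formal partial derivative with respect to [Z i], evaluated at [Z]. *)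
Inductive poly_grad : (T -> R[i]) -> (I -> T -> R[i]) -> Prop :=
| poly_grad_mono c k :
    poly_grad (fun t => c * (zmono k t)%:C)
      (fun i t => c * (k i)%:R * (zmono (kdecr k i) t)%:C)
| poly_gradD F D G D' : poly_grad F D -> poly_grad G D' ->
    poly_grad (fun t => F t + G t) (fun i t => D i t + D' i t).

Lemma zmonoD k k' t : zmono (fun i => k i + k' i)%N t = zmono k t * zmono k' t.
Proof. by rewrite -big_split; apply: eq_bigr => i _; rewrite exprD. Qed.

Lemma zmono_decr k k' i t : (0 < k i)%N ->
  zmono (kdecr (fun j => k j + k' j)%N i) t = zmono (kdecr k i) t * zmono k' t.
Proof.
move=> ki; rewrite -zmonoD; apply: eq_bigr => j _; congr (_ ^+ _).
by rewrite /kdecr; case: eqP => [<-|_]; rewrite ?subn0// addnBAC.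
Qed.

Lemma poly_grad_ext F D G D' : poly_grad F D -> F =1 G -> D =2 D' -> poly_grad G D'.
Proof.
move=> H /funext <- E; suff -> : D' = D by [].
by apply/funext => i; apply/funext => t; rewrite E.
Qed.

Lemma zmono_decrC k k' i t :
  (k i)%:R * (zmono (kdecr (fun j => k j + k' j)%N i) t)%:C =
  (k i)%:R * (zmono (kdecr k i) t)%:C * (zmono k' t)%:C :> R[i].
Proof.
have [->|] := posnP (k i); first by rewrite !mul0r.
by move=> /zmono_decr ->; rewrite rmorphM/= mulrA.
Qed.

Lemma poly_grad_monoM c k c' k' :
  poly_grad (fun t => c * (zmono k t)%:C * (c' * (zmono k' t)%:C))
    (fun i t => c * (k i)%:R * (zmono (kdecr k i) t)%:C * (c' * (zmono k' t)%:C) +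
       c * (zmono k t)%:C * (c' * (k' i)%:R * (zmono (kdecr k' i) t)%:C)).
Proof.
apply: (poly_grad_ext (poly_grad_mono (c * c') (fun i => k i + k' i)%N)).
  by move=> t; rewrite zmonoD rmorphM/=; ring.
move=> i t; rewrite natrD.
have E1 := zmono_decrC k k' i t.
have := zmono_decrC k' k i t.
rewrite (_ : (fun j => k' j + k j)%N = (fun j => k j + k' j)%N); last first.
  by apply/funext => j; rewrite addnC.
move=> E2; rewrite mulrDr mulrDl -!mulrA E1 E2; ring.
Qed.

Lemma poly_gradM F D G D' : poly_grad F D -> poly_grad G D' ->
  poly_grad (fun t => F t * G t) (fun i t => D i t * G t + F t * D' i t).
Proof.
move=> HF HG; elim: HF => [c k|F1 D1 F2 D2 H1 IH1 H2 IH2]; last first.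
  by apply: (poly_grad_ext (poly_gradD IH1 IH2)) => [t|i t]; ring.
elim: HG => [c' k'|F1 D1 F2 D2 H1 IH1 H2 IH2]; last first.
  by apply: (poly_grad_ext (poly_gradD IH1 IH2)) => [t|i t]; ring.
exact: poly_grad_monoM.
Qed.

Lemma poly_grad_const c : poly_grad (fun=> c) (fun _ _ => 0).
Proof.
apply: (poly_grad_ext (poly_grad_mono c (fun=> 0%N))) => [t|i t].
  by rewrite /zmono big1 ?mulr1// => i _; rewrite expr0.
by rewrite mulr0 mul0r.
Qed.

Lemma poly_grad_var j : poly_grad (fun t => (Z j t)%:C) (fun i _ => (i == j)%:R).
Proof.
apply: (poly_grad_ext (poly_grad_mono 1 (fun i => (i == j) : nat))) => [t|i t].
  rewrite mul1r /zmono (bigD1 j)//= eqxx expr1 big1 ?mulr1//.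
  by move=> i /negbTE ->; rewrite expr0.
rewrite mul1r; have [->|] := eqVneq i j; last by rewrite mul0r.
rewrite mul1r /zmono big1// => l _; rewrite /kdecr eq_sym.
by case: eqP => _; rewrite expr0.
Qed.

Let nu := normal_prob 0 s : probability (measurableTypeR R) R.

Lemma zmono_int k : P.-integrable setT (EFin \o zmono k).
Proof.
apply: (@integrable_prod _ _ _ P _ Z nu indep law (fun i x => x ^+ k i)) => i.
  exact: measurable_funX.
exact: integrable_normal_pow.
Qed.

Lemma Rintegral_zmono k : \int[P]_t zmono k t = \prod_i normal_moment s (k i).
Proof.
apply: (@Rintegral_prod _ _ _ P _ Z nu indep law (fun i x => x ^+ k i) (enum I)).
- by move=> i; exact: measurable_funX.
- by move=> i; exact: integrable_normal_pow.
- by move=> i; rewrite mem_enum.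
Qed.

Lemma poly_grad_cint F D : poly_grad F D -> cint P F /\ forall i, cint P (D i).
Proof.
elim=> [c k|F1 D1 F2 D2 _ [IH1 IH1'] _ [IH2 IH2']].
  by split => [|i]; apply: cintZ; apply: cint_real; exact: zmono_int.
by split => [|i]; exact: cintD.
Qed.

(** By linearity a monomial suffices. Its expectation is a product of one-dimensional moments; the
    factor of index [i] obeys [normal_momentS] and the others agree on both sides. *)
Lemma poly_grad_IBP F D i : poly_grad F D ->
  cE P (fun t => (Z i t)%:C * F t) = (s ^+ 2)%:C * cE P (D i).
Proof.
elim=> [c k|F1 D1 F2 D2 H1 IH1 H2 IH2].
  have E t : (Z i t)%:C * (c * (zmono k t)%:C) =
      c * (zmono (fun j => (j == i) + k j)%N t)%:C.
    rewrite zmonoD rmorphM/= mulrCA; congr (_ * (_%:C * _)).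
    rewrite /zmono (bigD1 i)//= eqxx expr1 big1 ?mulr1//.
    by move=> j /negbTE ->; rewrite expr0.
  rewrite (eq_cE _ E) !cEZ ?cE_real; try by apply: cint_real; exact: zmono_int.
  rewrite !Rintegral_zmono (bigD1 i)//= eqxx add1n normal_momentS//.
  rewrite [in RHS](bigD1 i)//= /kdecr eqxx subn1.
  rewrite (eq_bigr (fun j => normal_moment s (k j))); last first.
    by move=> j /negbTE ->.
  rewrite [in RHS](eq_bigr (fun j => normal_moment s (k j))); last first.
    by move=> j; rewrite eq_sym => /negbTE ->; rewrite subn0.
  by rewrite !rmorphM/= rmorph_nat; ring.
have [I1 J1] := poly_grad_cint H1; have [I2 J2] := poly_grad_cint H2.
have [K1 _] := poly_grad_cint (poly_gradM (poly_grad_var i) H1).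
have [K2 _] := poly_grad_cint (poly_gradM (poly_grad_var i) H2).
under eq_cE do rewrite mulrDr.
by rewrite !cED// IH1 IH2 mulrDr.
Qed.

End PolynomialVariables.

Section Monotone.
Local Open Scope complex_scope.
Context d (T : measurableType d) (R : realType) (P : probability T R).
Implicit Types (F G : T -> R[i]).

Lemma le_cE F G : cint P F -> cint P G -> (forall t, F t <= G t) -> cE P F <= cE P G.
Proof.
move=> [F1 F2] [G1 G2] FG; rewrite lecE /=; apply/andP; split; last first.
  by apply: le_Rintegral => // t _; have := FG t; rewrite lecE => /andP[].
by apply/eqP/eq_Rintegral => t _; have := FG t; rewrite lecE => /andP[/eqP].
Qed.

Lemma cE_cst (c : R[i]) : cE P (fun=> c) = c.
Proof.
apply: complex_eq; rewrite /= Rintegral_cst// /Rintegral /=.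
  by rewrite probability_setT /= mulr1.
by rewrite probability_setT /= mulr1.
Qed.
End Monotone.

Section Wirtinger.
Local Open Scope complex_scope.
Context d (T : measurableType d) (R : realType) (P : probability T R).
Context (m : nat) (X Y : 'I_m -> T -> R) (sg : R).
Hypothesis sg_gt0 : 0 < sg.
Hypothesis gaussXY : complex_gaussian_vector P X Y sg.
Implicit Types (F G : T -> R[i]) (D : 'I_m -> T -> R[i]).

Let Z (s : 'I_m + 'I_m) : T -> R := match s with inl i => X i | inr i => Y i end.
Let tau := Num.sqrt (sg ^+ 2 / 2).

Let tau_neq0 : tau != 0.
Proof. by rewrite gt_eqF// sqrtr_gt0 divr_gt0// exprn_gt0. Qed.

Let indepZ : mutually_independent P Z. Proof. by case: gaussXY. Qed.

Let lawZ i : has_normal_law P (Z i) 0 tau.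
Proof. by case: gaussXY => _ [HX HY]; case: i. Qed.

Let g s t : R[i] := cgvec X Y t s.

(* [wirtinger F D]: [F] is a polynomial in the Gaussian variables and their
   conjugates, and [D s] is its Wirtinger derivative with respect to the
   conjugate of the [s]-th variable. *)
Definition wirtinger F D := exists2 D0, poly_grad Z F D0 &
  forall s t, D s t = (D0 (inl s) t + 'i * D0 (inr s) t) / 2.

Lemma wirtinger_ext F D G D' : wirtinger F D -> F =1 G -> D =2 D' -> wirtinger G D'.
Proof.
move=> [D0 H E] /funext <- ED; exists D0 => // s t.
by rewrite -ED.
Qed.

Lemma wirtinger_const c : wirtinger (fun=> c) (fun _ _ => 0).
Proof.
exists (fun _ _ => 0); first exact: poly_grad_const.
by move=> s t; rewrite mulr0 addr0 mul0r.
Qed.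

Lemma wirtingerD F D G D' : wirtinger F D -> wirtinger G D' ->
  wirtinger (fun t => F t + G t) (fun s t => D s t + D' s t).
Proof.
move=> [D0 H E] [D0' H' E']; exists (fun i t => D0 i t + D0' i t).
  exact: poly_gradD.
by move=> s t; rewrite E E'; ring.
Qed.

Lemma wirtingerM F D G D' : wirtinger F D -> wirtinger G D' ->
  wirtinger (fun t => F t * G t) (fun s t => D s t * G t + F t * D' s t).
Proof.
move=> [D0 H E] [D0' H' E']; eexists; first exact: (poly_gradM H H').
by move=> s t; rewrite E E'; ring.
Qed.

Let i2 : 'i * 'i = -1 :> R[i].
Proof. by rewrite -expr2 sqr_i. Qed.

Let gE s t : g s t = (X s t)%:C + 'i * (Y s t)%:C.
Proof. by apply: complex_eq; rewrite ?RezD ?ImzD ?RezM ?ImzM /=; ring. Qed.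

Let gcE s t : (g s t)^*%R = (X s t)%:C - 'i * (Y s t)%:C.
Proof.
by apply: complex_eq => /=; ring.
Qed.

(** The derivative is [(1 + i i) / 2 = 0]: holomorphic factors behave as constants in the
    integration by parts. *)
Lemma wirtinger_var j : wirtinger (fun t => cgvec X Y t j) (fun _ _ => 0).
Proof.
have H := poly_gradD (poly_grad_var Z (inl j))
  (poly_gradM (poly_grad_const Z 'i) (poly_grad_var Z (inr j))).
eexists; first by apply: (poly_grad_ext H) => // t; rewrite -/(g j t) gE.
move=> s t /=.
rewrite !mul0r !add0r.
have -> : (inl s == inl j :> 'I_m + 'I_m) = (s == j) by [].
have -> : (inr s == inr j :> 'I_m + 'I_m) = (s == j) by [].
by rewrite mulr0 addr0 mulrA i2 mulN1r subrr mul0r.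
Qed.

Lemma wirtinger_conj j :
  wirtinger (fun t => (cgvec X Y t j)^*%R) (fun s _ => (s == j)%:R).
Proof.
have H := poly_gradD (poly_grad_var Z (inl j))
  (poly_gradM (poly_grad_const Z (- 'i)) (poly_grad_var Z (inr j))).
eexists; first by apply: (poly_grad_ext H) => // t; rewrite -/(g j t) gcE mulNr.
move=> s t /=; rewrite !mul0r !add0r.
have -> : (inl s == inl j :> 'I_m + 'I_m) = (s == j) by [].
have -> : (inr s == inr j :> 'I_m + 'I_m) = (s == j) by [].
by rewrite mulr0 addr0 mulrA mulrN i2 opprK mul1r; field.
Qed.

Lemma wirtinger_cint F D : wirtinger F D -> cint P F /\ forall s, cint P (D s).
Proof.
move=> [D0 H E]; have [I1 I2] := poly_grad_cint tau_neq0 indepZ lawZ H.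
split=> // s; have := cintZ 2^-1 (cintD (I2 (inl s)) (cintZ 'i (I2 (inr s)))).
by congr (cint P _); apply/funext => t; rewrite E mulrC.
Qed.

(** The real and imaginary parts contribute [sg^2 / 2] each, and the factor [1/2] inside the
    Wirtinger derivative turns this into [sg^2]. *)
Lemma wirtinger_IBP F D s : wirtinger F D ->
  cE P (fun t => cgvec X Y t s * F t) = (sg ^+ 2)%:C * cE P (D s).
Proof.
move=> [D0 H E]; have [I1 I2] := poly_grad_cint tau_neq0 indepZ lawZ H.
have IZ i : cint P (fun t => (Z i t)%:C * F t).
  exact: (poly_grad_cint tau_neq0 indepZ lawZ (poly_gradM (poly_grad_var Z i) H)).1.
transitivity (cE P (fun t => (Z (inl s) t)%:C * F t + 'i * ((Z (inr s) t)%:C * F t))).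
  by apply: eq_cE => t; rewrite -/(g s t) gE /=; ring.
rewrite cED//; last exact: cintZ.
rewrite cEZ// !(poly_grad_IBP tau_neq0 indepZ lawZ _ H).
have -> : cE P (D s) = cE P (fun t => 2^-1 * (D0 (inl s) t + 'i * D0 (inr s) t)).
  by apply: eq_cE => t; rewrite E mulrC.
rewrite cEZ ?cED ?cEZ//; try by [exact: cintZ | apply: cintD => //; exact: cintZ].
rewrite sqr_sqrtr ?divr_ge0 ?exprn_ge0 ?ltW//.
by rewrite rmorphM fmorphV /= rmorph_nat; field.
Qed.

Lemma wirtinger_sum (J : Type) (r : seq J) (Q : pred J) (F : J -> T -> R[i])
    (D : J -> 'I_m -> T -> R[i]) :
  (forall j, wirtinger (F j) (D j)) ->
  wirtinger (fun t => \sum_(j <- r | Q j) F j t) (fun s t => \sum_(j <- r | Q j) D j s t).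
Proof.
move=> H; elim: r => [|j r IH].
  by apply: (wirtinger_ext (wirtinger_const 0)) => [t|s t]; rewrite big_nil.
have [Qj|Qj] := boolP (Q j).
  by apply: (wirtinger_ext (wirtingerD (H j) IH)) => [t|s t]; rewrite big_cons Qj.
by apply: (wirtinger_ext IH) => [t|s t]; rewrite big_cons (negbTE Qj).
Qed.

Lemma wirtingerX F D q : wirtinger F D ->
  wirtinger (fun t => F t ^+ q) (fun s t => q%:R * F t ^+ q.-1 * D s t).
Proof.
move=> H; elim: q => [|q IH].
  by apply: (wirtinger_ext (wirtinger_const 1)) => [t|s t]; rewrite ?expr0 ?mul0r.
apply: (wirtinger_ext (wirtingerM H IH)) => [t|s t]; rewrite ?exprS//.
case: q {IH} => [|q] /=; first by rewrite !expr0; ring.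
by rewrite exprS -natr1; ring.
Qed.

End Wirtinger.

(** * Moments of Hermitian quadratic forms in the Gaussian vector *)

Section GaussianForms.
Local Open Scope complex_scope.
Context d (T : measurableType d) (R : realType) (P : probability T R).
Context (m : nat) (X Y : 'I_m -> T -> R) (sg : R).
Hypothesis sg_gt0 : 0 < sg.
Hypothesis gaussXY : complex_gaussian_vector P X Y sg.
Notation wirtinger := (wirtinger X Y).
Notation g s t := (cgvec X Y t s).
Implicit Types (F G : T -> R[i]) (D : 'I_m -> T -> R[i]).

Lemma cint_sum (J : Type) (r : seq J) (F : J -> T -> R[i]) :
  (forall j, cint P (F j)) -> cint P (fun t => \sum_(j <- r) F j t).
Proof.
move=> H; elim: r => [|j r IH].
  under eq_fun do rewrite big_nil.
  by split; exact: integrable0.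
by under eq_fun do rewrite big_cons; exact: cintD.
Qed.

Lemma cE_sum (J : Type) (r : seq J) (F : J -> T -> R[i]) :
  (forall j, cint P (F j)) ->
  cE P (fun t => \sum_(j <- r) F j t) = \sum_(j <- r) cE P (F j).
Proof.
move=> H; elim: r => [|j r IH].
  by under eq_cE do rewrite big_nil; rewrite big_nil cE_cst.
under eq_cE do rewrite big_cons; rewrite big_cons cED ?IH//.
exact: cint_sum.
Qed.

(** The coefficients may depend on [g] as long as they are holomorphic: they are constants for the
    quadratic forms, and entries of the derivatives [G s] for the traces. *)
Lemma wirtinger_IBP_sum (J : finType) (c : J -> 'I_m -> T -> R[i])
    (H : J -> T -> R[i]) (D : J -> 'I_m -> T -> R[i]) :
  (forall j s, wirtinger (c j s) (fun _ _ => 0)) ->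
  (forall j, wirtinger (H j) (D j)) ->
  cE P (fun t => \sum_j \sum_s g s t * (c j s t * H j t)) =
  (sg ^+ 2)%:C * cE P (fun t => \sum_j \sum_s c j s t * D j s t).
Proof.
move=> wc wH.
have K j s : wirtinger (fun t => c j s t * H j t) (fun s' t => c j s t * D j s' t).
  apply: (wirtinger_ext (wirtingerM (wc j s) (wH j))) => // s' t.
  by rewrite mul0r add0r.
have I0 j s : cint P (fun t => g s t * (c j s t * H j t)).
  exact: (wirtinger_cint sg_gt0 gaussXY (wirtingerM (wirtinger_var X Y s) (K j s))).1.
have I1 j s : cint P (fun t => c j s t * D j s t).
  exact: ((wirtinger_cint sg_gt0 gaussXY (K j s)).2 s).
rewrite !cE_sum; try by move=> j; exact: cint_sum.
rewrite mulr_sumr; apply: eq_bigr => j _.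
rewrite !cE_sum// mulr_sumr; apply: eq_bigr => s _.
exact: (wirtinger_IBP sg_gt0 gaussXY s (K j s)).
Qed.

Section QuadraticForm.
Variables (J : finType) (c : J -> 'I_m -> R[i]).

Definition glin (x : 'I_m -> R[i]) j := \sum_s c j s * x s.
Definition gform (x : 'I_m -> R[i]) := \sum_j `|glin x j| ^+ 2.

Lemma wirtinger_glin j : wirtinger (fun t => glin (cgvec X Y t) j) (fun _ _ => 0).
Proof.
have W s : wirtinger (fun t => c j s * g s t) (fun _ _ => 0).
  apply: (wirtinger_ext (wirtingerM (wirtinger_const X Y (c j s)) (wirtinger_var X Y s))) => // s' t.
  by rewrite mul0r mulr0 addr0.
apply: (wirtinger_ext (wirtinger_sum _ _ W)) => // s t.
by rewrite big1.
Qed.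

Lemma wirtinger_glin_conj j : wirtinger (fun t => (glin (cgvec X Y t) j)^*%R)
  (fun s _ => (c j s)^*%R).
Proof.
have W s := wirtingerM (wirtinger_const X Y (c j s)^*%R) (wirtinger_conj X Y s).
apply: (wirtinger_ext (wirtinger_sum _ _ W)) => [t|s t].
  by rewrite /glin rmorph_sum; apply: eq_bigr => s _; rewrite rmorphM.
rewrite (bigD1 s)//= eqxx mul0r add0r mulr1 big1 ?addr0// => s' ss'.
by rewrite mul0r add0r eq_sym (negbTE ss') mulr0.
Qed.

Lemma wirtinger_gform : wirtinger (fun t => gform (cgvec X Y t))
  (fun s t => \sum_j glin (cgvec X Y t) j * (c j s)^*%R).
Proof.
have W j := wirtingerM (wirtinger_glin j) (wirtinger_glin_conj j).
apply: (wirtinger_ext (wirtinger_sum _ _ W)) => [t|s t].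
  by apply: eq_bigr => j _; rewrite normCK.
by apply: eq_bigr => j _; rewrite mul0r add0r.
Qed.

Variables (f kappa : R[i]).
Hypothesis f_ge : \sum_j \sum_s `|c j s| ^+ 2 <= f.
Hypothesis kappa_ge0 : 0 <= kappa.
Hypothesis kappa_ge : forall x : J -> R[i],
  \sum_s `|\sum_j c j s * x j| ^+ 2 <= kappa * \sum_j `|x j| ^+ 2.

Lemma gform_ge0 x : 0 <= gform x.
Proof. by apply: sumr_ge0 => j _; rewrite exprn_ge0. Qed.

(** Here [f] bounds the squared Frobenius norm of [c] and [kappa] its squared operator norm. One
    factor of the form is written [glin] times its conjugate, and the linear factor is integrated by
    parts. The derivative of the conjugate yields [f]; that of the [q]-th power of the form yields
    [q] times its power [q - 1] times the squared norm of a vector that [kappa] bounds by the form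
    itself. *)
Lemma gform_moment_step q :
  cE P (fun t => gform (cgvec X Y t) ^+ q.+1) <=
  (sg ^+ 2)%:C * (f + q%:R * kappa) * cE P (fun t => gform (cgvec X Y t) ^+ q).
Proof.
pose F t := gform (cgvec X Y t).
have wH j := wirtingerM (wirtinger_glin_conj j) (wirtingerX q wirtinger_gform).
have E t : F t ^+ q.+1 = \sum_j \sum_s g s t * (c j s * ((glin (cgvec X Y t) j)^*%R * F t ^+ q)).
  rewrite exprS [X in X * _]/F/gform mulr_suml; apply: eq_bigr => j _.
  rewrite normCK {1}/glin mulr_suml mulr_suml; apply: eq_bigr => s _; ring.
rewrite (eq_cE _ E) (@wirtinger_IBP_sum _ (fun j s _ => c j s) _ _ _ wH); last first.
  by move=> j s; exact: wirtinger_const.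
rewrite -mulrA ler_wpM2l//.
  by rewrite ler0c exprn_ge0// ltW.
have IF := wirtinger_cint sg_gt0 gaussXY (wirtingerX q wirtinger_gform).
rewrite -cEZ; last exact: IF.1.
apply: le_cE => [||t].
- apply: cint_sum => j; apply: cint_sum => s.
  by apply: cintZ; exact: (wirtinger_cint sg_gt0 gaussXY (wH j)).2.
- by apply: cintZ; exact: IF.1.
have -> : \sum_j \sum_s c j s * ((c j s)^*%R * F t ^+ q + (glin (cgvec X Y t) j)^*%R *
     (q%:R * F t ^+ q.-1 * \sum_i glin (cgvec X Y t) i * (c i s)^*%R)) =
   (\sum_j \sum_s `|c j s| ^+ 2) * F t ^+ q +
   q%:R * F t ^+ q.-1 * \sum_s `|\sum_j c j s * (glin (cgvec X Y t) j)^*%R| ^+ 2.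
  rewrite exchange_big [in RHS]exchange_big/= mulr_suml mulr_sumr -big_split/=.
  apply: eq_bigr => s _; rewrite [in RHS]normCK.
  set S := \sum_i glin (cgvec X Y t) i * (c i s)^*%R.
  have -> : (\sum_i c i s * (glin (cgvec X Y t) i)^*%R)^*%R = S.
    by rewrite rmorph_sum; apply: eq_bigr => i _; rewrite rmorphM/= conjCK mulrC.
  have -> : q%:R * F t ^+ q.-1 * ((\sum_j c j s * (glin (cgvec X Y t) j)^*%R) * S) =
      \sum_j c j s * (glin (cgvec X Y t) j)^*%R * (S * (q%:R * F t ^+ q.-1)).
    by rewrite -mulr_suml; ring.
  rewrite mulr_suml -big_split/=; apply: eq_bigr => j _; rewrite normCK; ring.
have F0 : 0 <= F t := gform_ge0 _.
rewrite mulrDl lerD//; first by rewrite ler_wpM2r ?exprn_ge0.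
case: q {IF E wH} => [|q]; first by rewrite !mul0r.
rewrite exprSr -!mulrA ler_wpM2l ?ler0n//= mulrCA ler_wpM2l ?exprn_ge0//.
apply: le_trans (kappa_ge _) _; rewrite ler_wpM2l// le_eqVlt; apply/orP; left.
by apply/eqP/eq_bigr => j _; rewrite norm_conjC.
Qed.

Lemma gform_moment q :
  cE P (fun t => gform (cgvec X Y t) ^+ q) <= ((sg ^+ 2)%:C * (f + q%:R * kappa)) ^+ q.
Proof.
have f0 : 0 <= f.
  by apply: le_trans f_ge; apply: sumr_ge0 => j _; apply: sumr_ge0 => s _; rewrite exprn_ge0.
have sg0 : 0 <= (sg ^+ 2)%:C :> R[i] by rewrite ler0c exprn_ge0// ltW.
(* The factor is frozen at its value for [q], so that the product of the first [r] factors is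
   bounded by a power. *)
suff H r : (r <= q)%N -> cE P (fun t => gform (cgvec X Y t) ^+ r) <=
    ((sg ^+ 2)%:C * (f + q%:R * kappa)) ^+ r by exact: H.
elim: r => [|r IH] rq.
  by under eq_cE do rewrite expr0; rewrite cE_cst expr0.
apply: le_trans (gform_moment_step r) _.
rewrite [leRHS]exprS; apply: ler_pM.
- by rewrite mulr_ge0// addr_ge0// mulr_ge0.
- rewrite -(cE_cst P 0); apply: le_cE => [||t].
  + by split; exact: integrable0.
  + exact: (wirtinger_cint sg_gt0 gaussXY (wirtingerX r wirtinger_gform)).1.
  + by rewrite exprn_ge0// gform_ge0.
- rewrite ler_wpM2l// lerD2l ler_wpM2r// ler_nat; exact: ltnW.
- by apply: IH; exact: ltnW.
Qed.

End QuadraticForm.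
End GaussianForms.

(** * Trace moments of symmetric matrices *)

Section MatrixInequalities.
Local Open Scope sesquilinear_scope.
Variable C : numClosedFieldType.

Lemma lerXr (x y : C) k : 0 <= x -> x <= y -> x ^+ k <= y ^+ k.
Proof. by move=> x0 xy; apply: lerXn2r; rewrite ?nnegrE// (le_trans x0). Qed.

Lemma normCK_sum (I : finType) (a : I -> C) :
  `|\sum_i a i| ^+ 2 = \sum_i \sum_j a i * (a j)^*.
Proof.
rewrite normCK rmorph_sum mulr_suml; apply: eq_bigr => i _.
by rewrite mulr_sumr.
Qed.

(** Lagrange's identity: twice the gap between the two sides is a sum of squared moduli over all
    ordered pairs of indices. *)
Lemma cauchy_schwarz (I : finType) (a b : I -> C) :
  `|\sum_i a i * b i| ^+ 2 <= (\sum_i `|a i| ^+ 2) * (\sum_i `|b i| ^+ 2).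
Proof.
rewrite -(ler_pM2l (ltr0n C 2)) -subr_ge0.
rewrite (_ : _ - _ = \sum_i \sum_j `|a i * (b j)^* - a j * (b i)^*| ^+ 2); last first.
  pose S := \sum_i \sum_j `|a i| ^+ 2 * `|b j| ^+ 2.
  have S1 : (\sum_i `|a i| ^+ 2) * (\sum_i `|b i| ^+ 2) = S.
    by rewrite mulr_suml; apply: eq_bigr => i _; rewrite mulr_sumr.
  have S2 : S = \sum_i \sum_j `|a j| ^+ 2 * `|b i| ^+ 2 by rewrite /S exchange_big.
  pose N := \sum_i \sum_j a i * b i * (a j * b j)^*.
  have N2 : N = \sum_i \sum_j a j * b j * (a i * b i)^* by rewrite /N exchange_big.
  transitivity (S + \sum_i \sum_j `|a j| ^+ 2 * `|b i| ^+ 2 -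
      (N + \sum_i \sum_j a j * b j * (a i * b i)^*)).
    by rewrite -S2 -N2 S1 normCK_sum -/N; ring.
  rewrite -!big_split/= -sumrB; apply: eq_bigr => i _.
  rewrite -!big_split/= -sumrB; apply: eq_bigr => j _.
  by rewrite !normCK !rmorphB/= !rmorphM/= !conjCK; ring.
by apply: sumr_ge0 => i _; apply: sumr_ge0 => j _; rewrite exprn_ge0.
Qed.

Lemma norm_sum_sqr (I : finType) (a : I -> C) :
  `|\sum_i a i| ^+ 2 <= #|I|%:R * \sum_i `|a i| ^+ 2.
Proof.
have := cauchy_schwarz (fun _ : I => 1) a.
under [X in X * _]eq_bigr do rewrite normr1 expr1n.
rewrite sumr_const; under eq_bigr do rewrite mul1r.
by rewrite mulr_natl.
Qed.

(** If all values were below their weighted mean, the nonnegative gaps would have mean zero and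
    every weight would vanish. This is how an average over eigenvalues, characters or columns is
    replaced by a single term. *)
Lemma average_le_exists (I : finType) (c y : I -> C) :
  (forall i, 0 <= c i) -> (forall i, 0 <= y i) -> \sum_i c i = 1 ->
  exists i, \sum_j y j * c j <= y i.
Proof.
move=> c0 y0 c1; set s := \sum_j _.
have s0 : 0 <= s by apply: sumr_ge0 => i _; rewrite mulr_ge0.
apply/existsP; apply: contraT; rewrite negb_exists => /forallP H.
have lt i : y i < s by rewrite real_ltNge ?H// ger0_real.
have : \sum_i (s - y i) * c i = 0.
  under eq_bigr do rewrite mulrBl.
  by rewrite sumrB -mulr_sumr c1 mulr1 subrr.
move/psumr_eq0P => Z; have {}Z i : c i = 0.
  have : (s - y i) * c i = 0.
    by apply: Z => // k _; rewrite mulr_ge0// subr_ge0 ltW.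
  by move/eqP; rewrite mulf_eq0 subr_eq0 (gt_eqF (lt i))/= => /eqP.
by move: c1; rewrite big1// => /eqP; rewrite eq_sym oner_eq0.
Qed.

Definition nrm2 n (v : 'cV[C]_n) : C := \sum_i `|v i 0| ^+ 2.

Lemma nrm2_ge0 n (v : 'cV[C]_n) : 0 <= nrm2 v.
Proof. by apply: sumr_ge0 => i _; rewrite exprn_ge0. Qed.

Lemma nrm2E n (v : 'cV[C]_n) : nrm2 v = (v ^t* *m v) 0 0.
Proof. by rewrite mxE; apply: eq_bigr => i _; rewrite !mxE normCK mulrC. Qed.

Lemma nrm2_isometry p n (W : 'M[C]_(p, n)) v : W ^t* *m W = 1%:M ->
  nrm2 (W *m v) = nrm2 v.
Proof.
move=> WW; rewrite !nrm2E trmx_mul map_mxM -mulmxA [W ^t* *m _]mulmxA WW.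
by rewrite mul1mx.
Qed.

Lemma spectral_gram p n (M : 'M[C]_(p, n)) : exists U : 'M[C]_n, exists l : 'I_n -> C,
  [/\ U *m U ^t* = 1%:M, U ^t* *m U = 1%:M,
      M ^t* *m M = U *m diag_mx (\row_j l j) *m U ^t* & forall j, 0 <= l j].
Proof.
set A := M ^t* *m M.
have AH : A ^t* = A by rewrite trmx_mul map_mxM trmxCK.
have /orthomx_spectralP : A \is normalmx by apply/normalmxP; rewrite AH.
have := spectral_unitarymx A; set S := spectralmx A; set d := spectral_diag A.
move=> uS; rewrite invmx_unitary// => AE.
have SS : S *m S ^t* = 1%:M by apply/unitarymxP.
have SS' : S ^t* *m S = 1%:M by apply: mulmx1C.
exists (S ^t*), (fun j => d 0 j); rewrite trmxCK; split => //.
  by rewrite AE; congr (_ *m diag_mx _ *m _); apply/rowP => j; rewrite mxE.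
move=> j; have : (S *m A *m S ^t*) j j = d 0 j.
  rewrite AE !mulmxA SS mul1mx -mulmxA SS mulmx1.
  by rewrite mxE eqxx mulr1n.
move=> <-; have -> : S *m A *m S ^t* = (M *m S ^t*) ^t* *m (M *m S ^t*).
  by rewrite trmx_mul map_mxM trmxCK !mulmxA.
rewrite mxE; apply: sumr_ge0 => i _.
by rewrite !mxE mulrC -normCK exprn_ge0.
Qed.

Section Symmetric.
Variables (n : nat) (M : 'M[C]_n.+1) (U : 'M[C]_n.+1) (l : 'I_n.+1 -> C).
Hypothesis M_sym : M^T = M.
Hypothesis UU : U *m U ^t* = 1%:M.
Hypothesis UU' : U ^t* *m U = 1%:M.
Hypothesis ME : M ^t* *m M = U *m diag_mx (\row_j l j) *m U ^t*.
Hypothesis l_ge0 : forall j, 0 <= l j.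

Lemma gram_powE a : (M ^t* *m M) ^+ a = U *m diag_mx (\row_j l j ^+ a) *m U ^t*.
Proof.
elim: a => [|a IH].
  rewrite expr0 -[X in _ *m X *m _](_ : 1%:M = _) ?mulmx1 ?UU//.
  by apply/matrixP => i j; rewrite !mxE.
rewrite exprS IH ME; rewrite -[_ * _]/(_ *m _) !mulmxA.
rewrite -[_ *m U ^t* *m U]mulmxA UU' mulmx1.
rewrite -[X in X *m _ = _]mulmxA; congr (_ *m _ *m _).
apply/matrixP => i j; rewrite mul_diag_mx !mxE.
by case: eqP => _; rewrite ?mulr0n ?mulr0 // !mulr1n exprS.
Qed.

(** By symmetry [M ^t*] is the entrywise conjugate of [M]. Hence both Gram matrices have the
    eigenvalues [l], with eigenbases [U] and its conjugate. *)
Lemma cogram_conj : M *m M ^t* = map_mx Num.conj (M ^t* *m M).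
Proof.
rewrite map_mxM M_sym -map_mx_comp; congr (_ *m _).
by apply/matrixP => i j; rewrite !mxE /= conjCK.
Qed.

Lemma cogram_powE a : (M *m M ^t*) ^+ a =
  map_mx Num.conj U *m diag_mx (\row_j l j ^+ a) *m U^T.
Proof.
have -> : (M *m M ^t*) ^+ a = map_mx Num.conj ((M ^t* *m M) ^+ a).
  by rewrite cogram_conj rmorphXn.
rewrite gram_powE !map_mxM map_diag_mx -map_mx_comp; congr (_ *m diag_mx _ *m _).
  by apply/rowP => j; rewrite !mxE rmorphXn/= (CrealP _)// ger0_real.
by apply/matrixP => i j; rewrite !mxE /= conjCK.
Qed.

Lemma trace_cogram a : \tr ((M *m M ^t*) ^+ a) = \sum_j l j ^+ a.
Proof.
rewrite cogram_powE mxtrace_mulC mulmxA.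
have -> : U^T *m map_mx Num.conj U = 1%:M.
  have /(congr1 trmx) := UU'; rewrite trmx_mul trmx1 => <-; congr (_ *m _).
  by apply/matrixP => i j; rewrite !mxE.
by rewrite mul1mx mxtrace_diag; apply: eq_bigr => j _; rewrite mxE.
Qed.

(** Since the two eigenbases are conjugate, [G] is transported by the congruence [U^T G U], which is
    again symmetric, and all terms of the expansion are nonnegative. *)
Lemma trace_sandwich (G : 'M[C]_n.+1) a b : G^T = G ->
  \tr (G *m (M ^t* *m M) ^+ a *m G ^t* *m (M *m M ^t*) ^+ b) =
  \sum_i \sum_j `|(U^T *m G *m U) i j| ^+ 2 * (l j ^+ a * l i ^+ b).
Proof.
move=> Gs; rewrite gram_powE cogram_powE !mulmxA mxtrace_mulC !mulmxA.
set H := U^T *m G *m U.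
have HE : H ^t* = U ^t* *m G ^t* *m map_mx Num.conj U.
  by rewrite /H !trmx_mul !map_mxM trmxK mulmxA.
rewrite -[_ *m U ^t* *m _]mulmxA -[_ *m (_ *m _) *m map_mx _ _]mulmxA -HE.
rewrite /mxtrace; apply: eq_bigr => i _.
rewrite mul_mx_diag mxE mxE mulr_suml; apply: eq_bigr => j _.
rewrite mul_mx_diag !mxE normCK; ring.
Qed.

(* Young's inequality in the form [l^q x <= l^(q+1) / K + K^q x^(q+1)]. *)
Lemma trace_sandwich_le (J : finType) (G : J -> 'M[C]_n.+1) a b (K V : C) :
  (forall s, (G s)^T = G s) -> 0 < K ->
  (forall u : 'cV[C]_n.+1, nrm2 u = 1 ->
     (\sum_s nrm2 (G s *m u)) ^+ (a + b).+1 <= V) ->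
  \sum_s \tr (G s *m (M ^t* *m M) ^+ a *m (G s) ^t* *m (M *m M ^t*) ^+ b) <=
  2%:R * (\tr ((M *m M ^t*) ^+ (a + b).+1) / K + n.+1%:R * (K ^+ (a + b) * V)).
Proof.
move=> Gs K0 HV; set q := (a + b)%N.
(* The sum of pure powers separates the two indices; the two resulting sums agree by the symmetry of
   [U^T G U], whence the factor 2. *)
have lam i j : l j ^+ a * l i ^+ b <= l j ^+ q + l i ^+ q.
  have /orP[ij|ij] : (l i <= l j) || (l j <= l i) by apply: real_leVge; exact: ger0_real.
  - rewrite -[leLHS]addr0 lerD ?exprn_ge0// /q exprD ler_wpM2l ?exprn_ge0//.
    by apply: lerXr; rewrite ?l_ge0.
  - rewrite -[leLHS]add0r lerD ?exprn_ge0// /q exprD ler_wpM2r ?exprn_ge0//.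
    by apply: lerXr; rewrite ?l_ge0.
pose x j := \sum_s nrm2 (G s *m col j U).
have colE s j : \sum_i `|(U^T *m G s *m U) i j| ^+ 2 = nrm2 (G s *m col j U).
  have UT : (U^T) ^t* *m U^T = 1%:M.
    have /(congr1 trmx) := UU; rewrite trmx_mul trmx1 => <-; congr (_ *m _).
    by apply/matrixP => i' j'; rewrite !mxE.
  rewrite -(nrm2_isometry _ UT) /nrm2; apply: eq_bigr => i _.
  rewrite mulmxA; congr (`|_| ^+ 2); rewrite [LHS]mxE [RHS]mxE.
  by apply: eq_bigr => k _; rewrite [col _ _ _ _]mxE.
have Hsym s i j : (U^T *m G s *m U) i j = (U^T *m G s *m U) j i.
  suff E : (U^T *m G s *m U)^T = U^T *m G s *m U by rewrite -[in LHS]E mxE.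
  by rewrite !trmx_mul trmxK Gs mulmxA.
have x0 j : 0 <= x j by apply: sumr_ge0 => s _; exact: nrm2_ge0.
have xV j : x j ^+ q.+1 <= V.
  apply: HV; rewrite nrm2E; have /matrixP/(_ j j) := UU'.
  rewrite [RHS]mxE eqxx => U1; rewrite -[RHS]U1 [LHS]mxE [RHS]mxE.
  by apply: eq_bigr => i _; rewrite !mxE.
apply: (@le_trans _ _ (2%:R * \sum_j l j ^+ q * x j)).
  under eq_bigr do rewrite trace_sandwich//.
  apply: (@le_trans _ _ (\sum_s \sum_i \sum_j `|(U^T *m G s *m U) i j| ^+ 2 * (l j ^+ q + l i ^+ q))).
    apply: ler_sum => s _; apply: ler_sum => i _; apply: ler_sum => j _.
    by rewrite ler_wpM2l// exprn_ge0.
  have E s : \sum_i \sum_j `|(U^T *m G s *m U) i j| ^+ 2 * l j ^+ q =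
     \sum_j l j ^+ q * nrm2 (G s *m col j U).
    rewrite exchange_big; apply: eq_bigr => j _.
    by rewrite -colE -mulr_suml mulrC.
  have E' s : \sum_i \sum_j `|(U^T *m G s *m U) i j| ^+ 2 * l i ^+ q =
     \sum_j l j ^+ q * nrm2 (G s *m col j U).
    rewrite -E [RHS]exchange_big; apply: eq_bigr => i _; apply: eq_bigr => j _.
    by rewrite Hsym.
  under eq_bigr => s _.
    under eq_bigr => i _ do (under eq_bigr do rewrite mulrDr; rewrite big_split).
    rewrite big_split /= E E'; over.
  rewrite big_split/= mulr2n mulrDl mul1r exchange_big /=.
  under eq_bigr do rewrite -mulr_sumr.
  by [].
rewrite ler_wpM2l// trace_cogram mulr_suml.
have -> : n.+1%:R * (K ^+ q * V) = \sum_(j < n.+1) K ^+ q * V.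
  by rewrite sumr_const card_ord mulr_natl.
rewrite -big_split; apply: ler_sum => j _ /=.
have K0' := ltW K0.
have /orP[h|h] : (K * x j <= l j) || (l j <= K * x j).
  by apply: real_leVge; apply: ger0_real => //; rewrite mulr_ge0.
- rewrite -[leLHS]addr0 lerD//; last first.
    by rewrite mulr_ge0 ?exprn_ge0//; apply: le_trans (xV j); rewrite exprn_ge0.
  by rewrite ler_pdivlMr// exprSr -mulrA ler_wpM2l ?exprn_ge0// mulrC.
- rewrite -[leLHS]add0r lerD ?divr_ge0 ?exprn_ge0//.
  apply: (@le_trans _ _ ((K * x j) ^+ q * x j)).
    by rewrite ler_wpM2r//; apply: lerXr.
  by rewrite exprMn -mulrA -exprSr ler_wpM2l ?exprn_ge0.
Qed.

(** The form is bilinear, not Hermitian, so Cauchy-Schwarz first passes to [|M w|^2]. This is an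
    average of the eigenvalues [l] with weights of sum 1, hence below one of them, whose power is
    below the trace. *)
Lemma bilinear_form_le (w : 'cV[C]_n.+1) q : nrm2 w = 1 ->
  `|(w^T *m M *m w) 0 0| ^+ (2 * q) <= \tr ((M *m M ^t*) ^+ q).
Proof.
move=> w1; rewrite trace_cogram exprM.
pose c i := (U ^t* *m w) i 0.
have c1 : \sum_i `|c i| ^+ 2 = 1.
  by rewrite -w1 -(nrm2_isometry (W := U ^t*))// trmxCK.
pose y := \sum_i l i * `|c i| ^+ 2.
have yE : nrm2 (M *m w) = y.
  rewrite nrm2E trmx_mul map_mxM -mulmxA [M ^t* *m _]mulmxA ME.
  have -> : w ^t* *m (U *m diag_mx (\row_j l j) *m U ^t* *m w) =
     (U ^t* *m w) ^t* *m diag_mx (\row_j l j) *m (U ^t* *m w).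
    by rewrite trmx_mul map_mxM trmxCK !mulmxA.
  rewrite /y /c; move: (U ^t* *m w) => v.
  rewrite mul_mx_diag mxE; apply: eq_bigr => i _.
  by rewrite normCK !mxE; ring.
have y0 : 0 <= y by rewrite -yE nrm2_ge0.
have B : `|(w^T *m M *m w) 0 0| ^+ 2 <= y.
  rewrite -yE -mulmxA mxE.
  have := cauchy_schwarz (fun i => w^T 0 i) (fun i => (M *m w) i 0).
  move=> /le_trans; apply; under eq_bigr do rewrite mxE.
  by rewrite -/(nrm2 w) w1 mul1r.
apply: (@le_trans _ _ (y ^+ q)).
  by apply: lerXn2r => //; rewrite ?nnegrE ?exprn_ge0.
have [i yi] : exists i, y <= l i.
  by apply: average_le_exists => // i; rewrite exprn_ge0.
apply: (@le_trans _ _ (l i ^+ q)); first exact: lerXr.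
by rewrite (bigD1 i)//= lerDl; apply: sumr_ge0 => j _; rewrite exprn_ge0.
Qed.

End Symmetric.
End MatrixInequalities.

(** * Integration by parts for traces of powers *)

Section TraceMoments.
Local Open Scope complex_scope.
Local Open Scope sesquilinear_scope.
Context d (T : measurableType d) (R : realType) (P : probability T R).
Context (m : nat) (X Y : 'I_m -> T -> R) (sg : R).
Hypothesis sg_gt0 : 0 < sg.
Hypothesis gaussXY : complex_gaussian_vector P X Y sg.
Notation wirtinger := (wirtinger X Y).
Notation g s t := (cgvec X Y t s).

Definition wirtinger_mx p r (A : T -> 'M[R[i]]_(p, r)) (D : 'I_m -> T -> 'M[R[i]]_(p, r)) :=
  forall i j, wirtinger (fun t => A t i j) (fun s t => D s t i j).

Lemma wirtinger_mxM p r k (A : T -> 'M[R[i]]_(p, r)) DA (B : T -> 'M[R[i]]_(r, k)) DB :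
  wirtinger_mx A DA -> wirtinger_mx B DB ->
  wirtinger_mx (fun t => A t *m B t) (fun s t => DA s t *m B t + A t *m DB s t).
Proof.
move=> HA HB i j.
have W l := wirtingerM (HA i l) (HB l j).
apply: (wirtinger_ext (wirtinger_sum _ _ W)) => [t|s t]; first by rewrite mxE.
by rewrite !mxE -big_split.
Qed.

Lemma wirtinger_mxtrace p (A : T -> 'M[R[i]]_p) DA : wirtinger_mx A DA ->
  wirtinger (fun t => \tr (A t)) (fun s t => \tr (DA s t)).
Proof. by move=> HA; apply: wirtinger_sum => j. Qed.

Variables (n : nat) (M : T -> 'M[R[i]]_n.+1) (G : 'I_m -> T -> 'M[R[i]]_n.+1).
Hypothesis M_sym : forall t, (M t)^T = M t.
Hypothesis G_sym : forall s t, (G s t)^T = G s t.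
Hypothesis M_G : forall t, M t = 2^-1 *: \sum_s g s t *: G s t.
Hypothesis wM : wirtinger_mx M (fun _ _ => 0).
Hypothesis wG : forall s, wirtinger_mx (G s) (fun _ _ => 0).
Hypothesis wMc : wirtinger_mx (fun t => (M t) ^t*) (fun s t => (G s t) ^t*).

Let Mc t : 'M[R[i]]_n.+1 := (M t) ^t*.

(** The word is what remains of [(M Mc)^(q+1)] once its first letter is expanded by Euler's
    identity. Only the [q + 1] letters [Mc] involve conjugate variables; the term [a] differentiates
    the one preceded by [a] factors [Mc M]. *)
Lemma wirtinger_trace_word q : wirtinger_mx (fun t => Mc t * (M t * Mc t) ^+ q)
  (fun s t => \sum_(a < q.+1) (Mc t * M t) ^+ a * (G s t) ^t* * (M t * Mc t) ^+ (q - a)).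
Proof.
elim: q => [|q IH].
  move=> i j; apply: (wirtinger_ext (wMc i j)) => [t|s t].
    by rewrite expr0 mulr1.
  by rewrite big_ord_recl big_ord0 !expr0 mulr1 mul1r addr0.
move=> i j; apply: (wirtinger_ext (wirtinger_mxM IH (wirtinger_mxM wM wMc) i j)) => [t|s t].
  by rewrite exprSr mulrA.
rewrite mul0mx add0r; congr (fun_of_matrix _ i j).
rewrite [RHS]big_ord_recr/= subnn expr0 mulr1 -/(Mc t); congr (_ + _).
  rewrite -[_ *m (M t *m _)]/(_ * (M t * Mc t)) mulr_suml; apply: eq_bigr => a _.
  by rewrite subSn -1?ltnS// exprSr !mulrA.
rewrite mulmxA; congr (_ *m _); rewrite -[_ *m _]/(_ * _ * _).
elim: q {IH} => [|q IH]; first by rewrite expr0 mulr1 expr1.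
by rewrite exprSr 2!mulrA IH -!mulrA -exprSr.
Qed.

Lemma wirtinger_trace_pow q : exists D, wirtinger (fun t => \tr ((M t * Mc t) ^+ q)) D.
Proof.
suff [D H] : exists D, wirtinger_mx (fun t => (M t * Mc t) ^+ q) D.
  by eexists; exact: wirtinger_mxtrace H.
elim: q => [|q [D IH]].
  exists (fun _ _ => 0) => i j.
  by apply: (wirtinger_ext (wirtinger_const X Y ((1 : 'M[R[i]]_n.+1) i j))) => [t|s t]; rewrite ?expr0 ?mxE.
eexists => i j; apply: (wirtinger_ext (wirtinger_mxM (wirtinger_mxM wM wMc) IH i j)) => // t.
by rewrite exprS.
Qed.

Lemma cint_trace_pow q : cint P (fun t => \tr ((M t * Mc t) ^+ q)).
Proof.
by have [D H] := wirtinger_trace_pow q; exact: (wirtinger_cint sg_gt0 gaussXY H).1.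
Qed.

Lemma trace_wordE q t :
  \sum_(kl : 'I_n.+1 * 'I_n.+1) \sum_s G s t kl.1 kl.2 *
    (\sum_(a < q.+1) (Mc t * M t) ^+ a * (G s t) ^t* * (M t * Mc t) ^+ (q - a)) kl.2 kl.1 =
  \sum_(a < q.+1) \sum_s
    \tr (G s t * (Mc t * M t) ^+ a * (G s t) ^t* * (M t * Mc t) ^+ (q - a)).
Proof.
rewrite exchange_big/= [RHS]exchange_big/=; apply: eq_bigr => s _.
under [RHS]eq_bigr do rewrite -!mulrA /mxtrace.
rewrite [RHS]exchange_big/=.
under [RHS]eq_bigr do under eq_bigr do rewrite -[_ * (_ * _)]/(_ *m _) mxE.
under [RHS]eq_bigr do rewrite exchange_big/=.
rewrite pair_bigA/=; apply: eq_bigr => -[k l] _ /=.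
rewrite summxE mulr_sumr; apply: eq_bigr => a _.
by rewrite mulrA.
Qed.

Lemma cint_trace_word q : cint P (fun t => \sum_(a < q.+1) \sum_s
    \tr (G s t * (Mc t * M t) ^+ a * (G s t) ^t* * (M t * Mc t) ^+ (q - a))).
Proof.
under eq_fun do rewrite -trace_wordE.
apply: cint_sum => kl; apply: cint_sum => s.
have W := wirtingerM (wG s kl.1 kl.2) (wirtinger_trace_word q kl.2 kl.1).
have := (wirtinger_cint sg_gt0 gaussXY W).2 s.
by congr (cint P _); apply/funext => t; rewrite mxE mul0r add0r.
Qed.

Lemma trace_IBP q :
  cE P (fun t => \tr ((M t * Mc t) ^+ q.+1)) = (sg ^+ 2)%:C / 2 *
  cE P (fun t => \sum_(a < q.+1) \sum_s
    \tr (G s t * (Mc t * M t) ^+ a * (G s t) ^t* * (M t * Mc t) ^+ (q - a))).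
Proof.
pose H (kl : 'I_n.+1 * 'I_n.+1) t := (Mc t * (M t * Mc t) ^+ q) kl.2 kl.1.
have wc (kl : 'I_n.+1 * 'I_n.+1) s := wG s kl.1 kl.2.
have wc' kl s : wirtinger (fun t => G s t kl.1 kl.2) (fun _ _ => 0).
  by apply: (wirtinger_ext (wc kl s)) => // s' t; rewrite mxE.
have wH kl := wirtinger_trace_word q kl.2 kl.1.
have E t : 2 * \tr ((M t * Mc t) ^+ q.+1) =
    \sum_kl \sum_s g s t * (G s t kl.1 kl.2 * H kl t).
  rewrite exprS -mulrA /mxtrace mulr_sumr.
  under eq_bigr do rewrite -[_ * (_ * _)]/(_ *m _) mxE mulr_sumr.
  rewrite pair_bigA; apply: eq_bigr => -[k l] _.
  rewrite -/(H (k, l) t); move: (H (k, l) t) => h /=.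
  rewrite M_G mxE mulrA mulrA divff ?mul1r ?pnatr_eq0// summxE mulr_suml.
  by apply: eq_bigr => s _; rewrite mxE -mulrA.
have := eq_cE P E; rewrite cEZ; last exact: cint_trace_pow.
rewrite (wirtinger_IBP_sum sg_gt0 gaussXY wc' wH) => E2.
apply: (@mulfI _ 2); first by rewrite pnatr_eq0.
rewrite E2 mulrA mulrCA divff ?pnatr_eq0// mulr1; congr (_ * _).
by apply: eq_cE => t; exact: trace_wordE.
Qed.

Variables (q : nat) (V : T -> R[i]).
Hypothesis V_cint : cint P V.
Hypothesis V_ge : forall t (u : 'cV[R[i]]_n.+1), nrm2 u = 1 ->
  (\sum_s nrm2 (G s t *m u)) ^+ q.+1 <= V t.

Lemma trace_moment :
  cE P (fun t => \tr ((M t * Mc t) ^+ q.+1)) <=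
  ((2 * sg ^+ 2)%:C * q.+1%:R) ^+ q.+1 * n.+1%:R * cE P V.
Proof.
(* With this [K] the trace moment reappears on the right with the coefficient
   [(sg^2 / 2) (q+1) 2 / K = 1/2], and is absorbed by the left side. *)
set K := (2 * sg ^+ 2)%:C * q.+1%:R.
have s0 : 0 < (sg ^+ 2)%:C :> R[i] by rewrite ltcE/= eqxx exprn_gt0.
have K0 : 0 < K by rewrite mulr_gt0 ?ltr0n// rmorphM/= rmorph_nat mulr_gt0.
set Phi := cE P _.
have Kq : K = 4 * ((sg ^+ 2)%:C / 2 * q.+1%:R).
  by rewrite /K rmorphM/= rmorph_nat; field.
have B : Phi <= (sg ^+ 2)%:C / 2 * (q.+1%:R * (2 * (Phi / K + n.+1%:R * (K ^+ q * cE P V)))).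
  rewrite {1}/Phi [leLHS]trace_IBP; apply: ler_wpM2l.
    by rewrite divr_ge0// ltW.
  have I1 := cint_trace_pow q.+1.
  have -> : q.+1%:R * (2 * (Phi / K + n.+1%:R * (K ^+ q * cE P V))) =
    cE P (fun t => q.+1%:R * 2 / K * \tr ((M t * Mc t) ^+ q.+1) + q.+1%:R * 2 * n.+1%:R * K ^+ q * V t).
    rewrite cED; [|exact: cintZ|exact: cintZ].
    by rewrite !cEZ// -/Phi; ring.
  apply: le_cE => [||t].
  - exact: cint_trace_word.
  - by apply: cintD; exact: cintZ.
  - have [U [l [UU UU' ME l0]]] := spectral_gram (M t).
    apply: (@le_trans _ _ (\sum_(a < q.+1) 2%:R *
        (\tr ((M t *m (M t) ^t*) ^+ q.+1) / K + n.+1%:R * (K ^+ q * V t)))); last first.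
      rewrite sumr_const card_ord -mulr_natl le_eqVlt; apply/orP; left; apply/eqP.
      by rewrite -[M t *m _]/(M t * Mc t); ring.
    apply: ler_sum => a _.
    have aq : (a + (q - a))%N = q by rewrite subnKC// -ltnS.
    have := @trace_sandwich_le _ n (M t) U l (M_sym t) UU UU' ME l0 _ (fun s => G s t) a (q - a) K (V t)
      (G_sym^~ t) K0.
    by rewrite aq; apply; exact: V_ge.
have KE : (sg ^+ 2)%:C / 2 * q.+1%:R = K / 4 by rewrite Kq; field.
have : Phi <= Phi / 2 + K ^+ q.+1 * n.+1%:R * cE P V / 2.
  apply: le_trans B _; rewrite mulrA KE le_eqVlt; apply/orP; left; apply/eqP.
  by rewrite exprS; field; rewrite gt_eqF.
set A := K ^+ _ * _ * _ => H; rewrite -subr_ge0 in H; rewrite -subr_ge0.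
have -> : A - Phi = 2 * (Phi / 2 + A / 2 - Phi) by field.
by rewrite mulr_ge0.
Qed.

End TraceMoments.

(** * Window energies *)

Section Window.
Variable C : numClosedFieldType.

Lemma prim_root_exists L : (0 < L)%N -> exists z : C, L.-primitive_root z.
Proof.
pose p : {poly C} := 'X^L - 1; have [r Dp] := closed_field_poly_normal p.
move=> L0; rewrite (monicP _) ?monicXnsubC // scale1r in Dp.
have rn1 : all L.-unity_root r by apply/allP=> z; rewrite -root_prod_XsubC -Dp.
have sz_r : (L < (size r).+1)%N.
  by rewrite -(size_prod_XsubC r id) -Dp size_XnsubC.
have [|z] := hasP (has_prim_root L0 rn1 _ sz_r); last by exists z.
by rewrite -separable_prod_XsubC -Dp separable_Xn_sub_1 // pnatr_eq0 -lt0n.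
Qed.

Variables (L : nat) (z : C).
Hypothesis prim_z : L.-primitive_root z.

Let z_conj k : (z ^+ k)^* = z ^- k.
Proof.
have : `|z| ^+ L = 1 by rewrite -normrX (prim_expr_order prim_z) normr1.
move/eqP; rewrite pexpr_eq1 ?(prim_order_gt0 prim_z)// => /eqP nz.
rewrite -exprVn rmorphXn/=; congr (_ ^+ _).
have z0 : z != 0 by rewrite -normr_gt0 nz.
by apply: (mulfI z0); rewrite -normCK nz expr1n divff.
Qed.

Lemma dft_orthogonal (a b : 'I_L) :
  \sum_(w < L) z ^+ (w * a) * (z ^+ (w * b))^* = L%:R * (a == b)%:R.
Proof.
have [->|ab] := eqVneq a b.
  under eq_bigr => w _.
    rewrite z_conj divff; last by rewrite expf_neq0// (prim_root_eq0 prim_z) -lt0n (prim_order_gt0 prim_z).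
    over.
  by rewrite sumr_const card_ord mulr1.
pose r := z ^+ a * (z ^+ b)^*.
have rL : r ^+ L = 1.
  by rewrite exprMn -rmorphXn/= -!exprM ![(_ * L)%N]mulnC !exprM (prim_expr_order prim_z)
    !expr1n rmorph1 mulr1.
have r1 : r != 1.
  rewrite /r z_conj; apply: contra ab => /eqP.
  move=> /(congr1 (fun x => x * z ^+ b)); rewrite mul1r divfK; last first.
    by rewrite expf_neq0// (prim_root_eq0 prim_z) -lt0n (prim_order_gt0 prim_z).
  move=> /eqP; rewrite (eq_prim_root_expr prim_z) !modn_small//.
rewrite /= mulr0; apply: (mulfI (_ : r - 1 != 0)); first by rewrite subr_eq0.
rewrite mulr0 (eq_bigr (fun w : 'I_L => r ^+ w)); last first.
  by move=> w _; rewrite exprMn -rmorphXn/= -!exprM ![(w * _)%N]mulnC.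
by rewrite -subrX1 rL subrr.
Qed.

Lemma dft_parseval (a : 'I_L -> C) :
  \sum_(r < L) `|\sum_(w < L) a w * z ^+ (r * w)| ^+ 2 = L%:R * \sum_w `|a w| ^+ 2.
Proof.
under eq_bigr do rewrite normCK_sum.
rewrite exchange_big mulr_sumr; apply: eq_bigr => w _.
rewrite exchange_big (bigD1 w)//= [X in _ + X]big1 ?addr0.
  under eq_bigr do rewrite rmorphM mulrACA -normCK.
  by rewrite -mulr_sumr dft_orthogonal eqxx mulr1 mulrC.
move=> w' ww'; under eq_bigr do rewrite rmorphM mulrACA.
by rewrite -mulr_sumr dft_orthogonal eq_sym (negbTE ww') !mulr0.
Qed.

Lemma big_ord_pad n (F : nat -> C) : (n <= L)%N ->
  \sum_(k < n) F k = \sum_(k < L) (if (k < n)%N then F k else 0).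
Proof. by move=> nL; rewrite (big_ord_widen L)// big_mkcond. Qed.

Lemma dft_parseval_short n (u : nat -> C) : (n <= L)%N ->
  \sum_(w < L) `|\sum_(k < n) u k * z ^+ (w * k)| ^+ 2 = L%:R * \sum_(k < n) `|u k| ^+ 2.
Proof.
move=> nL; pose v (k : 'I_L) := if (k < n)%N then u k else 0.
rewrite (big_ord_pad (fun k => `|u k| ^+ 2) nL).
have -> : \sum_(k < L) (if (k < n)%N then `|u k| ^+ 2 else 0) = \sum_k `|v k| ^+ 2.
  by apply: eq_bigr => k _; rewrite /v; case: ifP; rewrite ?normr0 ?expr0n.
rewrite -dft_parseval; apply: eq_bigr => w _.
rewrite (big_ord_pad (fun k => u k * z ^+ (w * k)) nL).
by congr (`|_| ^+ 2); apply: eq_bigr => k _; rewrite /v; case: ifP; rewrite ?mul0r.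
Qed.

(** The condition [r + n <= L] keeps every index [r + k] below [L], so the cyclic correlation
    computed by the transform is the true one. *)
Lemma dft_correlation (y u : nat -> C) n r : (r + n <= L)%N ->
  \sum_(w < L) (\sum_(c < L) y c * (z ^+ (w * c))^*) * (\sum_(k < n) u k * z ^+ (w * k))
      * z ^+ (r * w) = L%:R * \sum_(k < n) y (r + k)%N * u k.
Proof.
move=> rnL; rewrite mulr_sumr.
transitivity (\sum_(k < n) \sum_(c < L) u k * y c *
    \sum_(w < L) z ^+ (w * (r + k)) * (z ^+ (w * c))^*).
  rewrite exchange_big; under [RHS]eq_bigr do under eq_bigr do rewrite mulr_sumr.
  under [RHS]eq_bigr do rewrite exchange_big.
  rewrite [RHS]exchange_big; apply: eq_bigr => w _ /=.
  rewrite !mulr_suml; apply: eq_bigr => c _.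
  rewrite mulr_sumr mulr_suml; apply: eq_bigr => k _.
  by rewrite mulnDr exprD (mulnC r); ring.
apply: eq_bigr => k _.
have rk : (r + k < L)%N by apply: leq_trans rnL; rewrite ltn_add2l.
rewrite (bigD1 (Ordinal rk))//= [X in _ + X]big1 ?addr0.
  by rewrite (dft_orthogonal (Ordinal rk) (Ordinal rk)) eqxx mulr1; ring.
move=> c cr; rewrite (dft_orthogonal (Ordinal rk) c) eq_sym (negbTE cr).
by rewrite !mulr0.
Qed.

End Window.

Section WindowBound.
Variables (C : numClosedFieldType) (J : finType) (tau : J -> J).
Hypothesis tau_inj : injective tau.
Variables (n : nat) (z : C).
Hypothesis n_gt0 : (0 < n)%N.
Let L := (n + n).-1.
Hypothesis prim_z : L.-primitive_root z.
Implicit Types (h : J -> C) (u : nat -> C).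

Definition window_energy h w := \sum_j `|\sum_(c < L) h (iter c tau j) * (z ^+ (w * c))^*| ^+ 2.

(* The length [L = 2 n - 1] makes the correlations of lag less than [n] free of
   wrap-around; averaging over these [n] lags gives the factor [n], and
   Parseval's identity turns the average into a convex combination of the window
   energies, with weights [|hu w|^2 / L]. *)
Lemma window_energy_ge h u : \sum_(k < n) `|u k| ^+ 2 = 1 ->
  exists w : 'I_L, n%:R * \sum_j `|\sum_(k < n) h (iter k tau j) * u k| ^+ 2 <=
    window_energy h w.
Proof.
move=> u1; have nL : (n <= L)%N by rewrite /L; lia.
have L0 : 0 < L%:R :> C by rewrite ltr0n; lia.
pose hu (w : 'I_L) := \sum_(k < n) u k * z ^+ (w * k).
have := @average_le_exists C _ (fun w => `|hu w| ^+ 2 / L%:R) (fun w : 'I_L => window_energy h w).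
case => [w|w||w].
- by rewrite divr_ge0 ?exprn_ge0.
- by apply: sumr_ge0 => j _; rewrite exprn_ge0.
- by rewrite -mulr_suml (dft_parseval_short prim_z)// u1 mulr1 divff ?gt_eqF.
move=> le_w; exists w; apply: le_trans le_w.
(* Each iterate of [tau] permutes [J], so the energy is the same at every lag [r]; its [n] copies
   are spread over the lags [r < n]. *)
have -> : n%:R * \sum_j `|\sum_(k < n) h (iter k tau j) * u k| ^+ 2 =
    \sum_j \sum_(r < n) `|\sum_(k < n) h (iter (r + k) tau j) * u k| ^+ 2.
  rewrite exchange_big /=; set S := (X in n%:R * X).
  have -> : n%:R * S = \sum_(r < n) S by rewrite sumr_const card_ord mulr_natl.
  apply: eq_bigr => r _.
  have inj : injective (iter r tau) by elim: (r : nat) => [|k IH] a b //= /tau_inj/IH.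
  rewrite /S [LHS](reindex_inj inj); apply: eq_bigr => j _; congr (`|_| ^+ 2).
  by apply: eq_bigr => k _; rewrite addnC iterD.
under [leRHS]eq_bigr do rewrite mulr_suml.
rewrite [leRHS]exchange_big; apply: ler_sum => j _ /=.
pose a (w : 'I_L) := (\sum_(c < L) h (iter c tau j) * (z ^+ (w * c))^*) * hu w.
apply: (@le_trans _ _ (\sum_(r < L) `|(L%:R)^-1 * \sum_(w < L) a w * z ^+ (r * w)| ^+ 2)).
  (* The lags [r >= n], where the transform may wrap around, only add nonnegative terms to the upper
     bound. *)
  rewrite (big_ord_widen L (fun r => `|\sum_(k < n) h (iter (r + k) tau j) * u k| ^+ 2))//.
  rewrite [leRHS](bigID (fun r : 'I_L => (r < n)%N))/= -[leLHS]addr0 lerD//; last first.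
    by apply: sumr_ge0 => r _; rewrite exprn_ge0.
  apply: ler_sum => r rn.
  have rnL : (r + n <= L)%N by move: rn n_gt0; rewrite /L; case: (r) => r' _ /=; lia.
  rewrite (dft_correlation prim_z (fun c => h (iter c tau j)) u rnL).
  by rewrite mulKf ?gt_eqF.
under [leLHS]eq_bigr do rewrite normrM exprMn.
rewrite -mulr_sumr (dft_parseval prim_z) normfV normr_nat.
have -> x : L%:R^-1 ^+ 2 * (L%:R * x) = L%:R^-1 * x :> C by field; rewrite gt_eqF.
rewrite mulr_sumr; apply: ler_sum => w' _.
by rewrite /a normrM exprMn le_eqVlt; apply/orP; left; apply/eqP; ring.
Qed.

End WindowBound.

(** * Linear forms assembled from shifts *)

Section ShiftForm.
Variables (C : numClosedFieldType) (J : finType) (tau pi : J -> J) (L : nat).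
Hypothesis tau_inj : injective tau.
Hypothesis pi_inj : injective pi.
Hypothesis orbit_inj : forall j, injective (fun k : 'I_L => iter k tau j).
Variables (a : J -> C) (zeta : 'I_L -> C) (beta : C).
Hypothesis beta_ge0 : 0 <= beta.
Hypothesis a_le : forall j, `|a j| <= beta.
Hypothesis zeta1 : forall k, `|zeta k| = 1.

(** The coefficient of [x s] in the modulated window at [j] of the sequence [a * (x \o pi)]; it
    gives window energies the shape of [gform]. *)
Definition shift_coef j s :=
  \sum_(k < L) (pi (iter k tau j) == s)%:R * (a (iter k tau j) * zeta k).

Lemma sum_delta (I : finType) (i : I) (y : I -> C) : \sum_j (i == j)%:R * y j = y i.
Proof.
rewrite (bigD1 i)//= eqxx mul1r big1 ?addr0// => j ji.
by rewrite eq_sym (negbTE ji) mul0r.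
Qed.

Lemma shift_coef_lin j (x : J -> C) : \sum_s shift_coef j s * x s =
  \sum_(k < L) a (iter k tau j) * x (pi (iter k tau j)) * zeta k.
Proof.
under eq_bigr do rewrite mulr_suml.
rewrite exchange_big; apply: eq_bigr => k _ /=.
under eq_bigr do rewrite -mulrA.
by rewrite sum_delta; ring.
Qed.

(** By injectivity along an orbit, at most one position of the window meets a given [s], so the
    modulated terms do not interfere. *)
Lemma norm_shift_coef j : \sum_s `|shift_coef j s| ^+ 2 <= L%:R * beta ^+ 2.
Proof.
have E s : `|shift_coef j s| ^+ 2 =
    \sum_(k < L) (pi (iter k tau j) == s)%:R * `|a (iter k tau j) * zeta k| ^+ 2.
  case: (pickP (fun k : 'I_L => pi (iter k tau j) == s)) => [k /eqP ks|none]; last first.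
    by rewrite /shift_coef !big1 ?normr0 ?expr0n// => k _; rewrite none mul0r.
  have H (k' : 'I_L) : (pi (iter k' tau j) == s) = (k == k').
    by rewrite -ks (inj_eq pi_inj) eq_sym (inj_eq (@orbit_inj j)).
  rewrite /shift_coef; under eq_bigr do rewrite H.
  by under [RHS]eq_bigr do rewrite H; rewrite !sum_delta.
under eq_bigr do rewrite E.
rewrite exchange_big.
have -> : L%:R * beta ^+ 2 = \sum_(k < L) beta ^+ 2 by rewrite sumr_const card_ord mulr_natl.
apply: ler_sum => k _ /=.
rewrite (sum_delta _ (fun=> `|a (iter k tau j) * zeta k| ^+ 2)) normrM zeta1 mulr1.
exact: lerXr.
Qed.

Lemma shift_coef_frobenius :
  \sum_j \sum_s `|shift_coef j s| ^+ 2 <= #|J|%:R * (L%:R * beta ^+ 2).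
Proof.
rewrite mulr_natl -sumr_const; apply: ler_sum => j _; exact: norm_shift_coef.
Qed.

Let iter_inj k : injective (iter k tau).
Proof. by elim: k => [|k IH] x y //= /tau_inj/IH. Qed.

(** The matrix is a sum of [L] weighted permutation matrices of norm at most [beta], so its norm is
    at most [L beta]. *)
Lemma shift_coef_op (y : J -> C) :
  \sum_s `|\sum_j shift_coef j s * y j| ^+ 2 <= L%:R ^+ 2 * beta ^+ 2 * \sum_j `|y j| ^+ 2.
Proof.
rewrite (reindex_inj pi_inj)/=.
have E t : \sum_j shift_coef j (pi t) * y j =
    \sum_(k < L) a t * zeta k * \sum_j (iter k tau j == t)%:R * y j.
  under eq_bigr do rewrite mulr_suml.
  rewrite exchange_big; apply: eq_bigr => k _ /=; rewrite mulr_sumr.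
  apply: eq_bigr => j _; rewrite (inj_eq pi_inj).
  by case: eqP => [->|_]; rewrite ?mul1r ?mul0r// !mulr0.
have S k : \sum_t `|\sum_j (iter k tau j == t)%:R * y j| ^+ 2 = \sum_j `|y j| ^+ 2.
  rewrite (reindex_inj (iter_inj (k := k)))/=; apply: eq_bigr => j _; congr (`|_| ^+ 2).
  under eq_bigr do rewrite (inj_eq (iter_inj (k := k))) eq_sym.
  exact: sum_delta.
apply: (@le_trans _ _ (\sum_t L%:R * \sum_(k < L) beta ^+ 2 *
    `|\sum_j (iter k tau j == t)%:R * y j| ^+ 2)).
  apply: ler_sum => t _; rewrite E; apply: le_trans (norm_sum_sqr _) _.
  rewrite card_ord ler_wpM2l//; apply: ler_sum => k _.
  rewrite normrM normrM zeta1 mulr1 exprMn ler_wpM2r ?exprn_ge0//.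
  exact: lerXr.
rewrite -mulr_sumr exchange_big/= expr2 -!mulrA ler_wpM2l//.
under eq_bigr do rewrite -mulr_sumr S.
by rewrite sumr_const card_ord -[leLHS]mulr_natl -mulrA.
Qed.

End ShiftForm.

Section CyclicShift.
Variable m : nat.
Implicit Types (j : 'I_m) (k : nat).

Lemma val_iter_ordS k j : val (iter k (@ordS m) j) = ((j + k) %% m)%N.
Proof.
elim: k => [|k IH] /=; first by rewrite addn0 modn_small.
by rewrite IH -addn1 modnDml addn1 addnS.
Qed.

Lemma iter_ordSK k : cancel (iter k (@ordS m)) (iter k (@ord_pred m)).
Proof. by elim: k => [|k IH] j //=; rewrite -iterS iterSr /= ordSK IH. Qed.

Lemma iter_ord_predK k : cancel (iter k (@ord_pred m)) (iter k (@ordS m)).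
Proof. by elim: k => [|k IH] j //=; rewrite -iterS iterSr /= ord_predK IH. Qed.

Lemma orbit_ordS_inj L j : (L <= m)%N -> injective (fun k : 'I_L => iter k (@ordS m) j).
Proof.
move=> Lm k k' /(congr1 val); rewrite !val_iter_ordS => /eqP.
rewrite eqn_modDl !modn_small; last 2 first.
- exact: leq_trans (ltn_ord k') Lm.
- exact: leq_trans (ltn_ord k) Lm.
by move=> /eqP/val_inj.
Qed.

Lemma orbit_ord_pred_inj L j : (L <= m)%N -> injective (fun k : 'I_L => iter k (@ord_pred m) j).
Proof.
move=> Lm.
suff H (k k' : 'I_L) : (k <= k')%N -> iter k (@ord_pred m) j = iter k' (@ord_pred m) j -> k = k'.
  move=> k k' E; case: (leqP k k') => [/H|/ltnW/H]; first exact.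
  by move=> /(_ (esym E)) ->.
move=> kk'; rewrite -(subnK kk') iterD; set y := iter k _ j => /(congr1 (iter (k' - k) (@ordS m))).
rewrite iter_ord_predK => E; apply/val_inj.
have k'L := ltn_ord k'.
have Lk : (k' - k < L)%N by lia.
have L0 : (0 < L)%N by lia.
have := @orbit_ordS_inj L y Lm (Ordinal Lk) (Ordinal L0) E.
by move=> /(congr1 val)/= ?; lia.
Qed.

(** The bound [k <= m] makes the natural subtraction exact, and the reduced index never meets the
    default value of [gat]. *)
Lemma gat_ord_pred (R : realType) (x : 'I_m -> R[i]) j k : (k <= m)%N ->
  gat x ((j + m - k) %% m) = x (iter k (@ord_pred m) j).
Proof.
move=> km; have m0 : (0 < m)%N by apply: leq_ltn_trans (ltn_ord j).
have lt : ((j + m - k) %% m < m)%N by rewrite ltn_mod.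
rewrite /gat insubT /=; congr (x _).
rewrite -[LHS](iter_ordSK k); congr (iter k _ _); apply/val_inj.
rewrite val_iter_ordS /= modnDml subnK ?modnDr ?modn_small//.
by rewrite (leq_trans km)// leq_addl.
Qed.

End CyclicShift.

(** * The chaos matrix *)

Section ChaosMatrix.
Local Open Scope sesquilinear_scope.
Variables (C : numClosedFieldType) (n m : nat) (b : 'I_m -> C) (beta : C) (z : C).
Let L := (n.+1 + n.+1).-1.
Hypothesis Lm : (L <= m)%N.
Hypothesis beta_ge0 : 0 <= beta.
Hypothesis b_le : forall j, `|b j| <= beta.
Hypothesis prim_z : L.-primitive_root z.
Implicit Types x : 'I_m -> C.

Notation pr k := (iter k (@ord_pred m)).
Notation sc k := (iter k (@ordS m)).

Definition chaosM x : 'M[C]_n.+1 :=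
  \matrix_(k, l) (m%:R^-1 * \sum_j b j * x (pr k j) * x (pr l j)).

(** The derivative of [chaosM] through its first factor [x (pr k j)] alone, which involves [x s]
    exactly when [j = sc k s]. Adding the transpose accounts for the second factor. *)
Definition chaosB x s : 'M[C]_n.+1 :=
  \matrix_(k, l) (m%:R^-1 * (b (sc k s) * x (pr l (sc k s)))).

Definition chaosG x s : 'M[C]_n.+1 := chaosB x s + (chaosB x s)^T.

Lemma chaosM_sym x : (chaosM x)^T = chaosM x.
Proof.
apply/matrixP => k l; rewrite !mxE; congr (_ * _); apply: eq_bigr => j _.
by rewrite mulrAC.
Qed.

Lemma chaosG_sym x s : (chaosG x s)^T = chaosG x s.
Proof. by rewrite /chaosG linearD/= trmxK addrC. Qed.

Let sc_inj k : injective (sc k).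
Proof. exact: can_inj (iter_ordSK k). Qed.

Let pr_inj k : injective (pr k).
Proof. exact: can_inj (iter_ord_predK k). Qed.

Lemma chaosM_B x : chaosM x = \sum_s x s *: chaosB x s.
Proof.
apply/matrixP => k l; rewrite mxE summxE (reindex_inj (@sc_inj (k : 'I_n.+1))) mulr_sumr.
apply: eq_bigr => s _; rewrite !mxE /= (iter_ordSK k); ring.
Qed.

Lemma chaosM_G x : chaosM x = 2^-1 *: \sum_s x s *: chaosG x s.
Proof.
have -> : \sum_s x s *: chaosG x s = chaosM x + (chaosM x)^T.
  rewrite chaosM_B linear_sum -big_split; apply: eq_bigr => s _ /=.
  by rewrite /chaosG scalerDr linearZ.
rewrite chaosM_sym; move: (chaosM x) => A.
by apply/matrixP => k l; rewrite !mxE; field.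
Qed.

(* The index [None] stands for the part [chaosB] of [chaosG], and [Some l] for the
   contribution of the [l]-th column of [chaosB] to its transpose. *)
Definition chaos_shift (o : option 'I_n.+1) := if o is Some _ then @ordS m else @ord_pred m.
Definition chaos_perm (o : option 'I_n.+1) : 'I_m -> 'I_m :=
  if o is Some l then pr l else id.
(** In a row of [chaosB x s *m v] the factor [b] stands outside the correlation and is replaced by
    its bound [beta]; in the transpose it varies with the summation index and must stay inside the
    window. *)
Definition chaos_weight (o : option 'I_n.+1) := if o is Some _ then b else fun=> beta.
Definition chaos_coef (o : option 'I_n.+1) (w : 'I_L) :=
  shift_coef (chaos_shift o) (chaos_perm o) (chaos_weight o)
    (fun c : 'I_L => (z ^+ (w * c))^*).
Definition chaos_energy x o w := \sum_j `|\sum_s chaos_coef o w j s * x s| ^+ 2.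

Let chaos_shift_inj o : injective (chaos_shift o).
Proof. by case: o => [l|]; [exact: (@sc_inj 1)|exact: (@pr_inj 1)]. Qed.

Let chaos_perm_inj o : injective (chaos_perm o).
Proof. by case: o => [l|] //=; exact: pr_inj. Qed.

Let chaos_orbit_inj o j : injective (fun k : 'I_L => iter k (chaos_shift o) j).
Proof. by case: o => [l|]; [exact: orbit_ordS_inj|exact: orbit_ord_pred_inj]. Qed.

Let chaos_weight_le o j : `|chaos_weight o j| <= beta.
Proof. by case: o => [l|] /=; [exact: b_le|rewrite ger0_norm]. Qed.

Let norm_z k : `|(z ^+ k)^*| = 1.
Proof.
have : `|z| ^+ L = 1 by rewrite -normrX (prim_expr_order prim_z) normr1.
move/eqP; rewrite pexpr_eq1 ?(prim_order_gt0 prim_z)// => /eqP nz.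
by rewrite norm_conjC normrX nz expr1n.
Qed.

Lemma chaos_coef_frobenius o w :
  \sum_j \sum_s `|chaos_coef o w j s| ^+ 2 <= m%:R * (L%:R * beta ^+ 2).
Proof.
rewrite -[X in X%:R * _](card_ord m).
by apply: shift_coef_frobenius => // j; exact: chaos_orbit_inj.
Qed.

Lemma chaos_coef_op o w (y : 'I_m -> C) :
  \sum_s `|\sum_j chaos_coef o w j s * y j| ^+ 2 <= L%:R ^+ 2 * beta ^+ 2 * \sum_j `|y j| ^+ 2.
Proof. exact: shift_coef_op. Qed.

Lemma chaos_energyE x o w : chaos_energy x o w =
  window_energy (chaos_shift o) n.+1 z (fun j => chaos_weight o j * x (chaos_perm o j)) w.
Proof.
by apply: eq_bigr => j _; congr (`|_| ^+ 2); rewrite shift_coef_lin.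
Qed.

Lemma chaos_energy_ge0 x o w : 0 <= chaos_energy x o w.
Proof. by apply: sumr_ge0 => j _; rewrite exprn_ge0. Qed.

Let psi x (v : 'cV[C]_n.+1) o := \sum_j `|\sum_(k < n.+1)
  chaos_weight o (iter k (chaos_shift o) j) * x (chaos_perm o (iter k (chaos_shift o) j)) * v k 0| ^+ 2.

Let psi_le x v o : nrm2 v = 1 -> exists w, n.+1%:R * psi x v o <= chaos_energy x o w.
Proof.
move=> v1; pose u k := v (inord k) 0.
have := @window_energy_ge C _ _ (@chaos_shift_inj o) n.+1 z isT prim_z
  (fun j => chaos_weight o j * x (chaos_perm o j)) u.
case=> [|w H].
  by rewrite -v1; apply: eq_bigr => k _; rewrite /u inord_val.
exists w; rewrite chaos_energyE; apply: le_trans H.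
rewrite le_eqVlt; apply/orP; left; apply/eqP; congr (_ * _).
apply: eq_bigr => j _; congr (`|_| ^+ 2); apply: eq_bigr => k _.
by rewrite /u inord_val.
Qed.

(** The substitution [j = sc k s] gives all [n.+1] rows the same sum over [j]. The factor [n.+1]
    that this costs is the one gained from the windows in [psi_le]. *)
Let sumB_le x v : \sum_s nrm2 (chaosB x s *m v) <= m%:R ^- 2 * (n.+1%:R * psi x v None).
Proof.
rewrite exchange_big /=.
have -> : n.+1%:R * psi x v None = \sum_(k < n.+1) psi x v None.
  by rewrite sumr_const card_ord mulr_natl.
rewrite mulr_sumr; apply: ler_sum => k _.
rewrite mulr_sumr.
have -> : \sum_s `|(chaosB x s *m v) k 0| ^+ 2 =
    \sum_j `|m%:R^-1 * (b j * \sum_(l < n.+1) x (pr l j) * v l 0)| ^+ 2.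
  rewrite [RHS](reindex_inj (@sc_inj (k : 'I_n.+1))); apply: eq_bigr => s _; congr (`|_| ^+ 2).
  by rewrite mxE !mulr_sumr; apply: eq_bigr => l _; rewrite mxE !mulrA.
apply: ler_sum => j _; rewrite normrM exprMn normfV normr_nat exprVn ler_wpM2l//.
have -> : \sum_(l < n.+1) chaos_weight None (iter l (chaos_shift None) j) *
    x (chaos_perm None (iter l (chaos_shift None) j)) * v l 0 =
    beta * \sum_(l < n.+1) x (pr l j) * v l 0.
  by rewrite mulr_sumr; apply: eq_bigr => l _; rewrite mulrA.
rewrite !normrM lerXr ?mulr_ge0// ler_wpM2r//.
by rewrite (ger0_norm beta_ge0).
Qed.

Let sumBT_le x v : \sum_s nrm2 ((chaosB x s)^T *m v) =
  m%:R ^- 2 * \sum_l psi x v (Some l).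
Proof.
rewrite exchange_big mulr_sumr /=; apply: eq_bigr => l _.
rewrite mulr_sumr; apply: eq_bigr => s _.
rewrite -exprVn -[m%:R^-1]ger0_norm ?invr_ge0// -exprMn -normrM; congr (`|_| ^+ 2).
by rewrite mxE mulr_sumr; apply: eq_bigr => k _; rewrite !mxE !mulrA.
Qed.

Lemma nrm2D_le k (u v : 'cV[C]_k) : nrm2 (u + v) <= 2 * (nrm2 u + nrm2 v).
Proof.
rewrite /nrm2 -big_split mulr_sumr; apply: ler_sum => i _ /=; rewrite mxE.
rewrite -subr_ge0 (_ : _ - _ = `|u i 0 - v i 0| ^+ 2) ?exprn_ge0//.
by rewrite !normCK !rmorphD !rmorphN/=; ring.
Qed.

(** For the transpose, [psi_le] turns the sum over [l] into an average of energies, hence at most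
    one of them. The constant 4 is 2 from [nrm2D_le] times 2 from keeping the larger of two
    energies. *)
Lemma chaosG_energy x v : nrm2 v = 1 -> exists o w,
  \sum_s nrm2 (chaosG x s *m v) <= 4 * m%:R ^- 2 * chaos_energy x o w.
Proof.
move=> v1.
have /choice[w Hw] : forall o, exists w, n.+1%:R * psi x v o <= chaos_energy x o w.
  by move=> o; exact: psi_le.
have [l0 Hl0] := @average_le_exists C _ (fun=> n.+1%:R^-1)
  (fun l : 'I_n.+1 => chaos_energy x (Some l) (w (Some l)))
  (fun=> ltac:(by rewrite invr_ge0)) (fun l => chaos_energy_ge0 _ _ _)
  ltac:(by rewrite sumr_const card_ord -[LHS]mulr_natl divff// pnatr_eq0).
set e0 := chaos_energy x None (w None).
set e1 := chaos_energy x (Some l0) (w (Some l0)) in Hl0.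
have A : \sum_s nrm2 (chaosG x s *m v) <= 2 * (m%:R ^- 2 * (e0 + e1)).
  apply: (@le_trans _ _ (2 * (\sum_s nrm2 (chaosB x s *m v) + \sum_s nrm2 ((chaosB x s)^T *m v)))).
    rewrite -big_split mulr_sumr; apply: ler_sum => s _ /=.
    by rewrite mulmxDl nrm2D_le.
  rewrite ler_wpM2l// mulrDr lerD//.
    apply: le_trans (sumB_le _ _) _; rewrite ler_wpM2l// invr_ge0 exprn_ge0//.
  rewrite sumBT_le ler_wpM2l// ?invr_ge0 ?exprn_ge0//.
  apply: le_trans Hl0; apply: ler_sum => l _.
  by rewrite ler_pdivlMr ?ltr0n// mulrC; exact: Hw.
have e00 : 0 <= e0 by exact: chaos_energy_ge0.
have e10 : 0 <= e1 by exact: chaos_energy_ge0.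
have m2 : 0 <= m%:R ^- 2 :> C by rewrite invr_ge0 exprn_ge0.
have /orP[h|h] : (e0 <= e1) || (e1 <= e0) by apply: real_leVge; exact: ger0_real.
- exists (Some l0), (w (Some l0)); apply: le_trans A _.
  have -> : 4 * m%:R ^- 2 * e1 = 2 * (m%:R ^- 2 * (e1 + e1)) by ring.
  by rewrite ler_wpM2l// ler_wpM2l// lerD.
- exists None, (w None); apply: le_trans A _.
  have -> : 4 * m%:R ^- 2 * e0 = 2 * (m%:R ^- 2 * (e0 + e0)) by ring.
  by rewrite ler_wpM2l// ler_wpM2l// lerD.
Qed.

(** A sum of powers in place of the maximum over windows keeps the majorant polynomial in [x] and
    its conjugate. *)
Definition chaosV x q := (4 * m%:R ^- 2) ^+ q * \sum_o \sum_w chaos_energy x o w ^+ q.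

Lemma chaosV_ge x v q : nrm2 v = 1 -> (\sum_s nrm2 (chaosG x s *m v)) ^+ q <= chaosV x q.
Proof.
move=> v1; have [ix [w H]] := chaosG_energy x v1.
apply: (@le_trans _ _ ((4 * m%:R ^- 2 * chaos_energy x ix w) ^+ q)).
  by apply: lerXr => //; apply: sumr_ge0 => s _; exact: nrm2_ge0.
rewrite exprMn ler_wpM2l ?exprn_ge0 ?mulr_ge0 ?invr_ge0 ?exprn_ge0//.
have E0 o' w' : 0 <= chaos_energy x o' w' ^+ q by rewrite exprn_ge0 ?chaos_energy_ge0.
rewrite (bigD1 ix)//= (bigD1 w)//= -addrA lerDl addr_ge0//.
  by apply: sumr_ge0 => w' _; exact: E0.
by apply: sumr_ge0 => o' _; apply: sumr_ge0 => w' _; exact: E0.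
Qed.

End ChaosMatrix.

Section ChaosMoment.
Local Open Scope complex_scope.
Local Open Scope sesquilinear_scope.
Context d (T : measurableType d) (R : realType) (P : probability T R).
Context (n m : nat) (X Y : 'I_m -> T -> R) (sg : R).
Hypothesis sg_gt0 : 0 < sg.
Hypothesis gaussXY : complex_gaussian_vector P X Y sg.
Variables (b : 'I_m -> R[i]) (beta : R).
Hypothesis beta_ge0 : 0 <= beta.
Hypothesis b_le : forall j, `|b j| <= beta%:C.
Let L := (n.+1 + n.+1).-1.
Hypothesis Lm : (L <= m)%N.
Notation wirtinger := (wirtinger X Y).
Notation x t := (cgvec X Y t).
Notation pr k := (iter k (@ord_pred m)).
Notation sc k := (iter k (@ordS m)).

Let M t := chaosM n b (x t).
Let G s t := chaosG n b (x t) s.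

Let holoM F F' : wirtinger F (fun _ _ => 0) -> wirtinger F' (fun _ _ => 0) ->
  wirtinger (fun t => F t * F' t) (fun _ _ => 0).
Proof.
by move=> H H'; apply: (wirtinger_ext (wirtingerM H H')) => // s t; rewrite mul0r mulr0 addr0.
Qed.

Let holo_sum (J : finType) (F : J -> T -> R[i]) :
  (forall j, wirtinger (F j) (fun _ _ => 0)) ->
  wirtinger (fun t => \sum_j F j t) (fun _ _ => 0).
Proof.
by move=> H; apply: (wirtinger_ext (wirtinger_sum _ _ H)) => // s t; rewrite big1.
Qed.

Lemma wirtinger_chaosM : wirtinger_mx X Y M (fun _ _ => 0).
Proof.
move=> k l.
suff H : wirtinger (fun t => m%:R^-1 * \sum_j b j * x t (pr k j) * x t (pr l j)) (fun _ _ => 0).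
  by apply: (wirtinger_ext H) => [t|s t]; rewrite !mxE.
apply: holoM; first exact: wirtinger_const.
apply: holo_sum => j; apply: holoM; last exact: wirtinger_var.
by apply: holoM; [exact: wirtinger_const|exact: wirtinger_var].
Qed.

Lemma wirtinger_chaosG s : wirtinger_mx X Y (G s) (fun _ _ => 0).
Proof.
have H k l : wirtinger (fun t => m%:R^-1 * (b (sc k s) * x t (pr l (sc k s)))) (fun _ _ => 0).
  apply: holoM; first exact: wirtinger_const.
  by apply: holoM; [exact: wirtinger_const|exact: wirtinger_var].
move=> k l; apply: (wirtinger_ext (wirtingerD (H k l) (H l k))) => [t|s' t].
  by rewrite !mxE.
by rewrite !mxE addr0.
Qed.

Lemma wirtinger_chaosM_conj :
  wirtinger_mx X Y (fun t => (M t) ^t*) (fun s t => (G s t) ^t*).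
Proof.
move=> k l.
have H j := wirtingerM (wirtinger_const X Y (m%:R^-1 * b j)^*%R)
  (wirtingerM (wirtinger_conj X Y (pr l j)) (wirtinger_conj X Y (pr k j))).
apply: (wirtinger_ext (wirtinger_sum _ _ H)) => [t|s t].
  rewrite !mxE mulr_sumr rmorph_sum; apply: eq_bigr => j _.
  by rewrite !rmorphM/= -!mulrA.
have E i j : (s == pr i j) = (sc i s == j).
  by rewrite -(inj_eq (can_inj (iter_ordSK i))) iter_ord_predK.
transitivity (\sum_j (sc l s == j)%:R * ((m%:R^-1 * b j)^*%R * (x t (pr k j))^*%R) +
    \sum_j (sc k s == j)%:R * ((m%:R^-1 * b j)^*%R * (x t (pr l j))^*%R)).
  rewrite -big_split; apply: eq_bigr => j _ /=.
  by rewrite mul0r add0r !E; ring.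
rewrite !sum_delta !mxE !rmorphD !rmorphM/=; ring.
Qed.

(** The factor [n.+2 * L] counts the pairs [(o, w)]; the last power is [gform_moment] with
    [f = m L beta^2] and [kappa = L^2 beta^2]. *)
Lemma chaos_trace_moment q :
  cE P (fun t => \tr ((M t * (M t) ^t*) ^+ q.+1)) <=
  ((2 * sg ^+ 2 * q.+1%:R) ^+ q.+1 * n.+1%:R *
   ((4 * m%:R ^- 2) ^+ q.+1 * (n.+2 * L)%:R *
    (sg ^+ 2 * (m%:R * (L%:R * beta ^+ 2) + q.+1%:R * (L%:R ^+ 2 * beta ^+ 2))) ^+ q.+1))%:C.
Proof.
have L0 : (0 < L)%N by rewrite /L; lia.
have [z prim_z] := @prim_root_exists R[i] L L0.
have bC : 0 <= beta%:C :> R[i] by rewrite ler0c.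
pose V t := chaosV n b beta%:C z (x t) q.+1.
pose E (o : option 'I_n.+1) (w : 'I_L) t := gform (chaos_coef b beta%:C z o w) (x t).
have EI o w : cint P (fun t => E o w t ^+ q.+1).
  exact: (wirtinger_cint sg_gt0 gaussXY (wirtingerX q.+1 (wirtinger_gform X Y _))).1.
have VI : cint P V.
  by apply: cintZ; apply: cint_sum => o; apply: cint_sum => w; exact: EI.
have HV t (u : 'cV[R[i]]_n.+1) : nrm2 u = 1 -> (\sum_s nrm2 (G s t *m u)) ^+ q.+1 <= V t.
  exact: chaosV_ge.
have := trace_moment sg_gt0 gaussXY (fun t => chaosM_sym n b (x t))
  (fun s t => chaosG_sym n b (x t) s) (fun t => chaosM_G n b (x t))
  wirtinger_chaosM wirtinger_chaosG wirtinger_chaosM_conj VI HV.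
move=> /le_trans; apply.
set B := (sg ^+ 2)%:C * (m%:R * (L%:R * beta%:C ^+ 2) + q.+1%:R * (L%:R ^+ 2 * beta%:C ^+ 2)) : R[i].
have EB o w : cE P (fun t => E o w t ^+ q.+1) <= B ^+ q.+1.
  apply: (gform_moment sg_gt0 gaussXY).
  - exact: chaos_coef_frobenius.
  - by rewrite mulr_ge0 ?exprn_ge0.
  - by move=> y; exact: chaos_coef_op.
have VB : cE P V <= (4 * m%:R ^- 2) ^+ q.+1 * ((n.+2 * L)%:R * B ^+ q.+1).
  rewrite /V /chaosV cEZ; last by apply: cint_sum => o; apply: cint_sum => w; exact: EI.
  rewrite ler_wpM2l ?exprn_ge0 ?mulr_ge0 ?invr_ge0 ?exprn_ge0//.
  rewrite cE_sum; last by move=> o; apply: cint_sum => w; exact: EI.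
  have -> : (n.+2 * L)%:R * B ^+ q.+1 = \sum_(o : option 'I_n.+1) \sum_(w < L) B ^+ q.+1.
    by rewrite !sumr_const card_option !card_ord -mulrnA mulr_natl mulnC.
  apply: ler_sum => o _; rewrite cE_sum; last by move=> w; exact: EI.
  by apply: ler_sum => w _; exact: EB.
have s0 : 0 <= (2 * sg ^+ 2)%:C :> R[i] by rewrite ler0c mulr_ge0// exprn_ge0// ltW.
apply: (@le_trans _ _ (((2 * sg ^+ 2)%:C * q.+1%:R) ^+ q.+1 * n.+1%:R *
    ((4 * m%:R ^- 2) ^+ q.+1 * ((n.+2 * L)%:R * B ^+ q.+1)))).
  by rewrite ler_wpM2l// mulr_ge0// exprn_ge0// mulr_ge0.
rewrite le_eqVlt; apply/orP; left; apply/eqP.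
rewrite /B !(rmorphM, rmorphXn, rmorphD, rmorph_nat, fmorphV)/=.
by rewrite !mulrA.
Qed.

End ChaosMoment.

(** * From the trace to the moments of the supremum *)

Section Supremum.
Local Open Scope complex_scope.
Local Open Scope sesquilinear_scope.
Variable R : realType.

Lemma normc_cabs (c : R[i]) : `|c| = (cabs c)%:C.
Proof. by case: c. Qed.

Lemma quadformE m n (g b : 'I_m -> R[i]) (w : 'cV[R[i]]_n.+1) : (n.+1 <= m)%N ->
  quadform g b w = (w^T *m chaosM n b g *m w) 0 0.
Proof.
move=> nm; pose W := circulant g *m zeropad R m n.+1.
have WE j k : W j k = g (iter k (@ord_pred m) j).
  rewrite mxE (bigD1 (widen_ord nm k))//= big1 ?addr0; last first.
    move=> i ik; rewrite !mxE (_ : (i : nat) == k = false) ?mulr0//.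
    by apply: contraNF ik => /eqP ik; apply/eqP/val_inj.
  by rewrite !mxE eqxx mulr1 gat_ord_pred// ltnW// (leq_trans (ltn_ord k)).
rewrite /quadform.
have -> : w^T *m (zeropad R m n.+1)^T *m (circulant g)^T *m cdiag b *m circulant g
    *m zeropad R m n.+1 *m w = w^T *m (W^T *m cdiag b *m W) *m w.
  by rewrite /W trmx_mul !mulmxA.
have -> : W^T *m cdiag b *m W = m%:R *: chaosM n b g.
  apply/matrixP => k l; rewrite mxE [RHS]mxE [chaosM _ _ _ _ _]mxE mulrA divff ?mul1r; last first.
    by rewrite pnatr_eq0 -lt0n; apply: leq_trans nm.
  apply: eq_bigr => j _; rewrite mul_mx_diag mxE [W^T _ _]mxE [(\row__ _) _ _]mxE !WE.
  by ring.
rewrite -scalemxAr -scalemxAl mxE mulrA mulVf ?mul1r//.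
by rewrite pnatr_eq0 -lt0n; apply: leq_trans nm.
Qed.

Lemma cabs_ge0 (c : R[i]) : 0 <= cabs c.
Proof. exact: sqrtr_ge0. Qed.

Lemma Nfun_pow_le m n (b g : 'I_m -> R[i]) q : (n.+1 <= m)%N ->
  0 <= Nfun n.+1 b g /\ Nfun n.+1 b g ^+ (2 * q.+1) <=
  complex.Re (\tr ((chaosM n b g *m (chaosM n b g) ^t*) ^+ q.+1)).
Proof.
move=> nm; set Q := \tr _.
have H (w : 'cV[R[i]]_n.+1) : unit_csphere w -> cabs (quadform g b w) ^+ (2 * q.+1) <= complex.Re Q.
  move=> w1; have [U [l [UU UU' ME l0]]] := spectral_gram (chaosM n b g).
  have nw : nrm2 w = 1.
    rewrite -[RHS](rmorph1 (real_complex R)) -w1 rmorph_sum; apply: eq_bigr => i _.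
    rewrite normc_cabs -rmorphXn /= /cabs sqr_sqrtr//.
    by rewrite addr_ge0 ?sqr_ge0.
  have := bilinear_form_le (chaosM_sym n b g) UU UU' ME l0 q.+1 nw.
  rewrite -quadformE// normc_cabs -rmorphXn lecE /= => /andP[_].
  exact.
(* A point of the sphere makes the set under [sup] nonempty; it also shows that the trace is
   nonnegative, so that its root is a genuine upper bound. *)
pose w0 : 'cV[R[i]]_n.+1 := delta_mx 0 0.
have w01 : unit_csphere w0.
  rewrite /unit_csphere /= /csqnorm (bigD1 0)//= mxE /= expr1n expr0n /= addr0.
  rewrite big1 ?addr0// => i i0; rewrite mxE (negbTE i0) /= expr0n /= addr0.
  by [].
have Q0 : 0 <= complex.Re Q := le_trans (exprn_ge0 _ (cabs_ge0 _)) (H _ w01).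
set S := [set y | exists2 w : 'cV[R[i]]_n.+1, unit_csphere w & y = cabs (quadform g b w)].
pose r := complex.Re Q `^ ((2 * q.+1)%:R)^-1.
have rE : r ^+ (2 * q.+1) = complex.Re Q.
  by rewrite -powR_mulrn ?powR_ge0// -powRrM mulVf ?powRr1// pnatr_eq0.
have S_le : ubound S r.
  move=> _ [w w1 ->]; rewrite -(@ler_pXn2r _ (2 * q.+1)) ?nnegrE ?cabs_ge0 ?powR_ge0//.
  by rewrite rE; exact: H.
have S0 : S !=set0 by exists (cabs (quadform g b w0)); exists w0.
have N0 : 0 <= Nfun n.+1 b g.
  apply: le_trans (cabs_ge0 (quadform g b w0)) _.
  by apply: ub_le_sup; [exists r | exists w0].
split=> //; rewrite -rE lerXn2r ?nnegrE ?powR_ge0//.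
exact: ge_sup.
Qed.

End Supremum.

Section LnormMoment.
Local Open Scope complex_scope.
Local Open Scope sesquilinear_scope.
Context d (T : measurableType d) (R : realType) (P : probability T R).

Lemma le_integral_nonmeasurable (f h : T -> \bar R) : (forall t, 0 <= f t)%E ->
  (forall t, f t <= h t)%E -> (\int[P]_t f t <= \int[P]_t h t)%E.
Proof.
move=> f0 fh; have h0 t : (0 <= h t)%E := le_trans (f0 t) (fh t).
rewrite !ge0_integralTE//; apply: ereal_sup_le => _ [s sf <-]; exists s => // t.
exact: le_trans (sf t) (fh t).
Qed.

(* [N] need not be measurable: the integral of a nonnegative function is a
   supremum over the simple functions below it, hence monotone. *)
Lemma Lnorm_le_moment (N Q : T -> R) (A : R) (p k : nat) : (0 < p)%N -> (p <= k)%N ->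
  0 < A -> (forall t, 0 <= N t) -> (forall t, N t ^+ k <= Q t) ->
  P.-integrable setT (EFin \o Q) -> \int[P]_t Q t <= A ^+ k ->
  (Lnorm P (p%:R)%:E (EFin \o N) <= (2 * A)%:E)%E.
Proof.
move=> p0 pk A0 N0 NQ IQ QA; rewrite unlock.
have pR : p%:R != 0 :> R by rewrite pnatr_eq0 -lt0n.
(* For [p <= k], either [N <= A] or the [k]-th power of [N / A] dominates the [p]-th, so
   [N^p <= A^p (1 + (N / A)^k)]. This pointwise bound replaces Jensen's inequality, which would ask
   for a measurable [N]. *)
have le_int : (\int[P]_x `|(EFin \o N) x| `^ p%:R <= (2 * A ^+ p)%:E)%E.
  apply: (@le_trans _ _ (\int[P]_t (A ^+ p * 1 + (A ^+ p / A ^+ k) * Q t)%:E)%E).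
    apply: le_integral_nonmeasurable => t; first exact: poweR_ge0.
    rewrite /= lee_fin ger0_norm// powR_mulrn//.
    have NA : 0 <= N t / A by rewrite divr_ge0// ltW.
    have -> : N t ^+ p = A ^+ p * (N t / A) ^+ p.
      by rewrite -exprMn mulrC divfK// gt_eqF.
    rewrite -mulrA -mulrDr ler_wpM2l ?exprn_ge0 ?(ltW A0)//.
    have Q0 : 0 <= (A ^+ k)^-1 * Q t.
      by rewrite mulr_ge0 ?invr_ge0 ?exprn_ge0 ?(ltW A0)//; apply: le_trans (NQ t); rewrite exprn_ge0.
    have [N1|N1] := leP (N t / A) 1.
      by rewrite -[leLHS]addr0 lerD// exprn_ile1.
    rewrite -[leLHS]add0r lerD//; apply: (@le_trans _ _ ((N t / A) ^+ k)).
      by apply: ler_weXn2l => //; exact: ltW.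
    by rewrite expr_div_n mulrC ler_wpM2l// invr_ge0 exprn_ge0// ltW.
  have I1 : P.-integrable setT (EFin \o (fun=> 1 : R)).
    exact: finite_measure_integrable_cst.
  have IL := integrable_lin (A ^+ p) (A ^+ p / A ^+ k) I1 IQ.
  rewrite -(@fineK _ (\int[P]_t _)%E); last exact: integrable_fin_num IL.
  rewrite lee_fin -/(Rintegral _ _ _) Rintegral_lin// Rintegral_cst// /Rintegral.
  have PT : fine (P setT) = 1 := congr1 fine (probability_setT P).
  rewrite /= in PT; rewrite /= PT !mulr1 mulr2n mulrDl mul1r lerD2l.
  rewrite -[leRHS](divfK (_ : A ^+ k != 0)); last by rewrite gt_eqF// exprn_gt0.
  by rewrite ler_wpM2l// divr_ge0 ?exprn_ge0 ?(ltW A0).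
apply: (@le_trans _ _ (((2 * A) ^+ p)%:E `^ (p%:R)^-1)%E).
  have le_pow : (\int[P]_x `|(EFin \o N) x| `^ p%:R <= ((2 * A) ^+ p)%:E)%E.
    apply: le_trans le_int _; rewrite lee_fin exprMn ler_wpM2r ?exprn_ge0 ?(ltW A0)//.
    by rewrite -[leLHS]expr1; apply: ler_weXn2l => //; rewrite ler1n.
  have int0 : (0 <= \int[P]_x `|(EFin \o N) x| `^ p%:R)%E.
    by apply: integral_ge0 => t _; exact: poweR_ge0.
  apply: gt0_ler_poweR => //.
  - by rewrite in_itv/= int0 leey.
  - by rewrite in_itv/= (le_trans int0 le_pow) leey.
have A2 : 0 <= 2 * A by rewrite mulr_ge0// ltW.
by rewrite poweR_EFin -powR_mulrn// -powRrM mulfV// powRr1.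
Qed.

End LnormMoment.

Section NfunMoment.
Local Open Scope complex_scope.
Local Open Scope sesquilinear_scope.
Context d (T : measurableType d) (R : realType) (P : probability T R).

Lemma Lnorm_Nfun_le (n m : nat) (X Y : 'I_m -> T -> R) (sg : R) (b : 'I_m -> R[i])
    (beta A : R) (p q : nat) :
  0 < sg -> complex_gaussian_vector P X Y sg ->
  0 <= beta -> (forall j, cabs (b j) <= beta) ->
  (n < m)%N -> ((n.+1 + n.+1).-1 <= m)%N -> (0 < p)%N -> (p <= 2 * q.+1)%N -> 0 < A ->
  (2 * sg ^+ 2 * q.+1%:R) ^+ q.+1 * n.+1%:R *
   ((4 * m%:R ^- 2) ^+ q.+1 * (n.+2 * (n.+1 + n.+1).-1)%:R *
    (sg ^+ 2 * (m%:R * ((n.+1 + n.+1).-1%:R * beta ^+ 2) +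
       q.+1%:R * ((n.+1 + n.+1).-1%:R ^+ 2 * beta ^+ 2))) ^+ q.+1) <= A ^+ (2 * q.+1) ->
  (Lnorm P p%:R%:E (fun t => (Nfun n.+1 b (cgvec X Y t))%:E) <= (2 * A)%:E)%E.
Proof.
move=> sg0 gXY b0 b_le nm Lm p0 pq A0 QA.
have b_le' j : `|b j| <= beta%:C by rewrite normc_cabs lecR.
pose Q t := complex.Re (\tr ((chaosM n b (cgvec X Y t) *m (chaosM n b (cgvec X Y t)) ^t*) ^+ q.+1)).
apply: (@Lnorm_le_moment _ _ _ P _ Q A p (2 * q.+1)) => //.
- by move=> t; exact: (Nfun_pow_le b (cgvec X Y t) q nm).1.
- by move=> t; exact: (Nfun_pow_le b (cgvec X Y t) q nm).2.
- have [I _] := cint_trace_pow sg0 gXY (@wirtinger_chaosM _ _ _ n _ X Y b)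
    (@wirtinger_chaosM_conj _ _ _ n _ X Y b) q.+1.
  exact: I.
have := chaos_trace_moment sg0 gXY b0 b_le' Lm q.
by rewrite lecE => /andP[_] /= /le_trans; apply.
Qed.

End NfunMoment.

(** * Absorbing the polynomial factors and comparing logarithms *)

Section Numerics.
Variable R : realType.

(** From [exp (-1/2) >= 1 - 1/2]. *)
Lemma ln2_ge : 2^-1 <= ln 2 :> R.
Proof.
rewrite -ler_expR lnK ?posrE//.
have := @expR_ge1Dx R (- 2^-1); rewrite expRN => H.
rewrite -(ler_pM2r (_ : 0 < (expR 2^-1)^-1 * 2^-1)) ?mulr_gt0 ?invr_gt0 ?expR_gt0//.
rewrite mulrA mulfV ?mul1r ?gt_eqF ?expR_gt0// mulrCA mulfV// mulr1.
by apply: le_trans H; lra.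
Qed.

(** The counting factor satisfies [N M L <= 4 N^3 <= (4 e^3)^(q+1)], and the remaining base is at
    most [D], by [L <= 2 N]. With [s^2 = (q+1) N / m], the number [4 e^3 D] equals
    [64 e^3 sg^4 beta^2 s^2 (1 + 2 s^2)], and [8 e^2] rounds up the square root of [64 e^3]. *)
Lemma moment_bound_le (N L M q m : nat) (sg beta : R) : (0 < N)%N -> (L <= 2 * N)%N ->
  (M <= 2 * N)%N -> (0 < m)%N -> 0 < sg -> 0 < beta -> N%:R <= expR (q.+1%:R) :> R ->
  (2 * sg ^+ 2 * q.+1%:R) ^+ q.+1 * N%:R *
   ((4 * m%:R ^- 2) ^+ q.+1 * (M * L)%:R *
    (sg ^+ 2 * (m%:R * (L%:R * beta ^+ 2) + q.+1%:R * (L%:R ^+ 2 * beta ^+ 2))) ^+ q.+1) <=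
  (8 * expR 1 ^+ 2 * sg ^+ 2 * beta *
    (Num.sqrt (q.+1%:R * (N%:R / m%:R)) + 2 * (q.+1%:R * (N%:R / m%:R)))) ^+ (2 * q.+1).
Proof.
move=> N0 LN MN m0 sg0 b0 Ne.
set Q : R := q.+1%:R; set a := N%:R / m%:R.
have Q0 : 0 < Q by rewrite ltr0n.
have mR : 0 < m%:R :> R by rewrite ltr0n.
have NR : 0 < N%:R :> R by rewrite ltr0n.
have a0 : 0 < a by rewrite divr_gt0.
have LR : L%:R <= 2 * N%:R :> R by rewrite -natrM ler_nat.
have MR : M%:R <= 2 * N%:R :> R by rewrite -natrM ler_nat.
set e : R := expR 1.
have e1 : 1 <= e by apply: le_trans (expR_ge1Dx 1); rewrite lerDl.
have e0 : 0 < e by exact: expR_gt0.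
have Ne' : N%:R <= e ^+ q.+1 :> R by rewrite /e -expRM_natl mulr1.
pose s := Num.sqrt (Q * a).
have s0 : 0 <= s by exact: sqrtr_ge0.
have s2 : s ^+ 2 = Q * a by rewrite sqr_sqrtr// mulr_ge0// ltW.
pose D := 16 * sg ^+ 4 * beta ^+ 2 * (Q * a) * (1 + 2 * (Q * a)).
have D0 : 0 <= D.
  by rewrite /D !mulr_ge0 ?exprn_ge0 ?(ltW sg0) ?(ltW b0) ?(ltW Q0) ?(ltW a0)//
    addr_ge0 ?mulr_ge0 ?(ltW Q0) ?(ltW a0).
rewrite exprM.
apply: (@le_trans _ _ ((4 * e ^+ 3 * D) ^+ q.+1)); last first.
  apply: lerXn2r; rewrite ?nnegrE.
  - by rewrite mulr_ge0// mulr_ge0// exprn_ge0// ltW.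
  - by rewrite exprn_ge0// !mulr_ge0 ?exprn_ge0 ?addr_ge0 ?mulr_ge0
      ?(ltW sg0) ?(ltW b0) ?(ltW e0) ?(ltW Q0) ?(ltW a0).
  rewrite -/s -s2 /D -s2.
  have -> : (8 * e ^+ 2 * sg ^+ 2 * beta * (s + 2 * s ^+ 2)) ^+ 2 =
     e * (64 * e ^+ 3 * sg ^+ 4 * beta ^+ 2 * s ^+ 2 * (1 + 2 * s) ^+ 2) by ring.
  have -> : 4 * e ^+ 3 * (16 * sg ^+ 4 * beta ^+ 2 * s ^+ 2 * (1 + 2 * s ^+ 2)) =
     1 * (64 * e ^+ 3 * sg ^+ 4 * beta ^+ 2 * s ^+ 2 * (1 + 2 * s ^+ 2)) by ring.
  have c0 : 0 <= 64 * e ^+ 3 * sg ^+ 4 * beta ^+ 2 * s ^+ 2.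
    by rewrite !mulr_ge0 ?exprn_ge0 ?(ltW sg0) ?(ltW b0) ?(ltW e0).
  apply: ler_pM => //; first by rewrite mulr_ge0// addr_ge0// mulr_ge0// exprn_ge0.
  rewrite ler_wpM2l//; nra.
have step : 2 * sg ^+ 2 * Q * (4 * m%:R ^- 2) *
    (sg ^+ 2 * (m%:R * (L%:R * beta ^+ 2) + Q * (L%:R ^+ 2 * beta ^+ 2))) <= D.
  have -> : 2 * sg ^+ 2 * Q * (4 * m%:R ^- 2) *
    (sg ^+ 2 * (m%:R * (L%:R * beta ^+ 2) + Q * (L%:R ^+ 2 * beta ^+ 2))) =
    8 * sg ^+ 4 * beta ^+ 2 * Q * (L%:R / m%:R) * (1 + Q * (L%:R / m%:R)).
    by field; rewrite gt_eqF.
  have -> : D = 8 * sg ^+ 4 * beta ^+ 2 * Q * (2 * a) * (1 + Q * (2 * a)) by rewrite /D; ring.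
  have La : L%:R / m%:R <= 2 * a by rewrite /a mulrA ler_pM2r ?invr_gt0.
  have L0 : 0 <= L%:R / m%:R :> R by rewrite divr_ge0.
  have c0 : 0 <= 8 * sg ^+ 4 * beta ^+ 2 * Q by rewrite !mulr_ge0 ?exprn_ge0 ?(ltW sg0) ?(ltW b0) ?(ltW Q0).
  apply: ler_pM.
  - by rewrite mulr_ge0.
  - by rewrite addr_ge0// mulr_ge0// ltW.
  - by rewrite ler_wpM2l.
  - by rewrite lerD2l ler_wpM2l// ltW.
have -> : (2 * sg ^+ 2 * Q) ^+ q.+1 * N%:R *
   ((4 * m%:R ^- 2) ^+ q.+1 * (M * L)%:R *
    (sg ^+ 2 * (m%:R * (L%:R * beta ^+ 2) + Q * (L%:R ^+ 2 * beta ^+ 2))) ^+ q.+1) =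
  (N%:R * (M%:R * L%:R)) * (2 * sg ^+ 2 * Q * (4 * m%:R ^- 2) *
    (sg ^+ 2 * (m%:R * (L%:R * beta ^+ 2) + Q * (L%:R ^+ 2 * beta ^+ 2)))) ^+ q.+1.
  by rewrite natrM !exprMn; ring.
rewrite [leRHS]exprMn; apply: ler_pM.
- by rewrite !mulr_ge0.
- apply: exprn_ge0; rewrite !mulr_ge0 ?invr_ge0 ?exprn_ge0 ?addr_ge0 ?mulr_ge0
    ?exprn_ge0 ?(ltW sg0) ?(ltW b0) ?(ltW Q0)//.
- apply: (@le_trans _ _ (N%:R * ((2 * N%:R) * (2 * N%:R)))).
    by rewrite ler_wpM2l ?(ltW NR)// ler_pM.
  have -> : N%:R * (2 * N%:R * (2 * N%:R)) = 4 * N%:R ^+ 3 :> R by ring.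
  rewrite exprMn; apply: ler_pM => //.
    by rewrite -[leLHS]expr1; apply: ler_weXn2l => //; rewrite ler1n.
  rewrite exprAC; apply: lerXn2r; rewrite ?nnegrE ?(ltW NR)//.
  by rewrite exprn_ge0// ltW.
- apply: lerXn2r; rewrite ?nnegrE//.
  by rewrite !mulr_ge0 ?invr_ge0 ?exprn_ge0 ?addr_ge0 ?mulr_ge0 ?exprn_ge0 ?(ltW sg0) ?(ltW b0) ?(ltW Q0).
Qed.

(** As [N <= m], the product [l] is at least [x^2] with [x = ln N]. For [N >= 2] one has [x >= 1/2],
    so [x <= 2 x^2] and [x <= 8 x^4]; for [N = 1] the left sides vanish. *)
Lemma log_power_ge (N m : nat) : (0 < N)%N -> (N <= m)%N ->
  let l := ln (N%:R : R) `^ (3 / 2) * ln (m%:R : R) `^ (1 / 2) in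
  ln (N%:R : R) <= 2 * l /\ Num.sqrt (ln (N%:R : R)) <= 4 * l.
Proof.
move=> N0 Nm l.
have l0 : 0 <= l by rewrite mulr_ge0 ?powR_ge0.
have [->|N1] := eqVneq N 1%N; first by rewrite ln1 sqrtr0; split; rewrite mulr_ge0.
have NR : 0 < N%:R :> R by rewrite ltr0n.
have mR : 0 < m%:R :> R by rewrite ltr0n (leq_trans N0).
set x := ln (N%:R : R).
have x2 : 2^-1 <= x.
  by apply: le_trans ln2_ge _; rewrite ler_ln ?posrE// ler_nat; lia.
have x0 : 0 < x by apply: lt_le_trans x2.
have xm : x <= ln m%:R by rewrite ler_ln ?posrE// ler_nat.
have lx : x ^+ 2 <= l.
  have -> : x ^+ 2 = x `^ (3 / 2) * x `^ (1 / 2).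
    rewrite -powRD; last by rewrite (gt_eqF x0) implybT.
    have -> : 3 / 2 + 1 / 2 = 2%:R :> R by field.
    by rewrite powR_mulrn// ltW.
  rewrite ler_wpM2l ?powR_ge0//; apply: ge0_ler_powR => //.
  - by rewrite nnegrE ltW.
  - by rewrite nnegrE (le_trans (ltW x0)).
split; first by nra.
rewrite -(@ler_pXn2r _ 2) ?nnegrE ?sqrtr_ge0 ?(mulr_ge0 _ l0)//.
rewrite sqr_sqrtr ?(ltW x0)//.
have : x ^+ 4 <= l ^+ 2 by rewrite -[4%N]/(2 * 2)%N exprM lerXn2r ?nnegrE ?exprn_ge0// ltW.
have x3 : 2^-1 ^+ 3 <= x ^+ 3 by rewrite lerXn2r ?nnegrE// ltW.
have : x * 2^-1 ^+ 3 <= x ^+ 4 by rewrite exprS ler_wpM2l// ltW.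
have -> : (2^-1 : R) ^+ 3 = 8^-1 by field.
have -> : (4 * l) ^+ 2 = 16 * l ^+ 2 by ring.
have := sqr_ge0 l; move: (l ^+ 2) (x ^+ 4) => l2 x4; lra.
Qed.

(** The target has no term [a x]; since [a <= 1], it is moved into the term with [sqrt a]. The
    coefficient of [sqrt a * l] is then 4 from the root plus 4 from the linear part. *)
Lemma sqrt_linear_bound (a l x p Q : R) : 0 < a -> a <= 1 -> 0 <= l -> 0 <= x -> 0 <= p ->
  0 <= Q -> Q <= 2 * p + x -> x <= 2 * l -> Num.sqrt x <= 4 * l ->
  Num.sqrt (Q * a) + 2 * (Q * a) <= 8 * (Num.sqrt a * l + Num.sqrt a * Num.sqrt p + a * p).
Proof.
move=> a0 a1 l0 x0 p0 Q0 Qle xl sxl.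
set sa := Num.sqrt a; set sp := Num.sqrt p.
have sa0 : 0 <= sa := sqrtr_ge0 _.
have sp0 : 0 <= sp := sqrtr_ge0 _.
have sx0 : 0 <= Num.sqrt x := sqrtr_ge0 _.
have saE : sa ^+ 2 = a by rewrite sqr_sqrtr// ltW.
have spE : sp ^+ 2 = p by rewrite sqr_sqrtr.
have sxE : Num.sqrt x ^+ 2 = x by rewrite sqr_sqrtr.
have sa1 : sa <= 1 by rewrite -sqrtr1 ler_wsqrtr.
have H1 : Num.sqrt (Q * a) <= (2 * sp + Num.sqrt x) * sa.
  have R0 : 0 <= (2 * sp + Num.sqrt x) * sa by rewrite mulr_ge0// addr_ge0// mulr_ge0.
  rewrite -(@ler_pXn2r _ 2) ?nnegrE ?sqrtr_ge0// sqr_sqrtr ?mulr_ge0// ?(ltW a0)//.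
  rewrite exprMn saE ler_wpM2r ?(ltW a0)//.
  have := mulr_ge0 sp0 sx0; nra.
have H2 : (2 * sp + Num.sqrt x) * sa <= 2 * (sa * sp) + 4 * (sa * l).
  have -> : (2 * sp + Num.sqrt x) * sa = 2 * (sa * sp) + Num.sqrt x * sa by ring.
  have -> : 4 * (sa * l) = 4 * l * sa by ring.
  by rewrite lerD2l ler_wpM2r.
have H3 : Q * a <= 2 * (a * p) + 2 * (sa * l).
  apply: (@le_trans _ _ ((2 * p + x) * a)); first by rewrite ler_wpM2r// ltW.
  have : x * a <= 2 * l * sa.
    rewrite -[in leLHS]saE expr2 mulrA; apply: ler_pM => //.
      by rewrite mulr_ge0.
    by rewrite -[leRHS]mulr1; apply: ler_pM.
  lra.
have := mulr_ge0 sa0 sp0; have := mulr_ge0 sa0 l0; have := mulr_ge0 (ltW a0) p0.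
lra.
Qed.

End Numerics.

(** * Choice of the exponent and of the constants *)

Theorem theorem7 (R : realType) :
  exists C : R, 0 < C /\
  forall sg : R, 0 < sg ->
  exists Csg : R, 0 < Csg /\
  forall (d : measure_display) (T : measurableType d) (P : probability T R)
         (n m : nat) (X Y : 'I_m -> T -> R) (b : 'I_m -> R[i]) (p : nat),
    (0 < n)%N -> (n <= m)%N ->
    C * n%:R * (ln (n%:R : R)) ^+ 4 <= m%:R ->
    complex_gaussian_vector P X Y sg ->
    (1 <= p)%N ->
    (Lnorm P (p%:R)%:E (fun t => (Nfun n b (cgvec X Y t))%:E)
     <= (Csg * cinfnorm b *
         (Num.sqrt (n%:R / m%:R) * powR (ln (n%:R : R)) (3 / 2)
                                  * powR (ln (m%:R : R)) (1 / 2)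
          + Num.sqrt (n%:R / m%:R) * Num.sqrt (p%:R)
          + n%:R / m%:R * p%:R))%:E)%E.
Proof.
(* The constant only serves to force [2 n - 1 <= m]. *)
exists 32; split => // sg sg0.
pose e : R := expR 1.
have e0 : 0 < e := expR_gt0 1.
(* Here 128 is 2 from [Lnorm_le_moment], times 8 from [moment_bound_le], times 8 from
   [sqrt_linear_bound]. *)
exists (128 * e ^+ 2 * sg ^+ 2); split.
  by rewrite !mulr_gt0 ?exprn_gt0//.
move=> d T P [//|n] m X Y b p _ nm Hm gXY p1.
have m0 : (0 < m)%N by apply: leq_trans nm.
have mR : 0 < m%:R :> R by rewrite ltr0n.
set a : R := n.+1%:R / m%:R.
have a0 : 0 < a by rewrite divr_gt0.
have a1 : a <= 1 by rewrite ler_pdivrMr// mul1r ler_nat.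
set x := ln (n.+1%:R : R) in Hm *.
have x0 : 0 <= x by rewrite ln_ge0// ler1n.
pose l := x `^ (3 / 2) * ln (m%:R : R) `^ (1 / 2).
have [xl sxl] : x <= 2 * l /\ Num.sqrt x <= 4 * l := @log_power_ge R n.+1 m isT nm.
have l0 : 0 <= l by rewrite mulr_ge0 ?powR_ge0.
rewrite -[Num.sqrt a * _ * _]mulrA -/l.
set K := Num.sqrt a * l + Num.sqrt a * Num.sqrt p%:R + a * p%:R.
have K0 : 0 < K.
  apply: ltr_wpDl; last by rewrite mulr_gt0// ltr0n.
  by rewrite addr_ge0// mulr_ge0// sqrtr_ge0.
(* In dimension one the logarithm vanishes but the window has length 1. Otherwise [x >= 1/2], and 32
   is chosen so that [32 (1/2)^4 = 2]. *)
have Lm : ((n.+1 + n.+1).-1 <= m)%N.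
  have [n0|n0] := posnP n; first by rewrite n0.
  have x2 : 2^-1 <= x.
    by apply: le_trans (@ln2_ge R) _; rewrite ler_ln ?posrE// ler_nat.
  have x4 : (2^-1) ^+ 4 <= x ^+ 4 by rewrite lerXn2r ?nnegrE.
  have : (2 * n.+1)%:R <= m%:R :> R.
    apply: le_trans Hm; rewrite natrM.
    have -> : 2%:R * n.+1%:R = 32 * n.+1%:R * (2^-1) ^+ 4 :> R by field.
    by rewrite ler_wpM2l.
  rewrite ler_nat mul2n -addnn; exact/leq_trans/leq_pred.
(* The exponent must dominate [x], so that the dimension is at most [e^(q+1)], and must give
   [p <= 2 (q+1)], while staying below [2 p + x]; the last bound uses [p >= 1]. *)
pose q := (p + Num.truncn x)%N.
have qx : x <= q.+1%:R.
  by apply: le_trans (ltW (truncnS_gt x)) _; rewrite ler_nat ltnS leq_addl.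
have qp : q.+1%:R <= 2 * p%:R + x :> R.
  rewrite -natr1 natrD.
  have : (Num.truncn x)%:R <= x by rewrite truncn_le.
  have : 1 <= p%:R :> R by rewrite ler1n.
  lra.
(* [b] may vanish, whereas the moment comparison divides by [A]; hence a positive [beta] above the
   norm, which is recovered as a limit. *)
suff key beta : 0 < beta -> cinfnorm b <= beta ->
    (Lnorm P p%:R%:E (fun t => (Nfun n.+1 b (cgvec X Y t))%:E) <=
     (128 * e ^+ 2 * sg ^+ 2 * beta * K)%:E)%E.
  have c0 : 0 <= cinfnorm b by apply: bigmax_ge_id.
  have D0 : 0 < 128 * e ^+ 2 * sg ^+ 2 * K.
    by rewrite !mulr_gt0 ?exprn_gt0//.
  apply/lee_addgt0Pr => eps eps0.
  have := key (cinfnorm b + eps / (128 * e ^+ 2 * sg ^+ 2 * K)).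
  rewrite ltr_wpDl ?divr_gt0// lerDl ltW ?divr_gt0// => /(_ isT isT) /le_trans; apply.
  rewrite -EFinD lee_fin le_eqVlt; apply/orP; left; apply/eqP.
  by move: (K) K0 => K' K'0; field; rewrite !gt_eqF ?expR_gt0.
move=> b0 cb.
have b_le j : cabs (b j) <= beta.
  by apply: le_trans cb; exact: (le_bigmax _ (fun j => cabs (b j))).
pose A := 8 * e ^+ 2 * sg ^+ 2 * beta * (Num.sqrt (q.+1%:R * a) + 2 * (q.+1%:R * a)).
have A0 : 0 < A.
  apply: mulr_gt0; first by rewrite !mulr_gt0 ?exprn_gt0//.
  have qa0 : 0 < q.+1%:R * a by rewrite mulr_gt0 ?ltr0n.
  by apply: (ltr_wpDl (sqrtr_ge0 _)); rewrite mulr_gt0.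
have A_le : 2 * A <= 128 * e ^+ 2 * sg ^+ 2 * beta * K.
  have := sqrt_linear_bound a0 a1 l0 x0 (ler0n R p) (ler0n R q.+1) qp xl sxl.
  rewrite -/K => H.
  have -> : 2 * A = 16 * e ^+ 2 * sg ^+ 2 * beta * (Num.sqrt (q.+1%:R * a) + 2 * (q.+1%:R * a)).
    by rewrite /A; ring.
  have -> : 128 * e ^+ 2 * sg ^+ 2 * beta * K = 16 * e ^+ 2 * sg ^+ 2 * beta * (8 * K) by ring.
  by rewrite ler_wpM2l// !mulr_ge0 ?exprn_ge0 ?(ltW sg0) ?(ltW b0) ?(ltW e0).
apply: (@le_trans _ _ (2 * A)%:E); last by rewrite lee_fin.
apply: (@Lnorm_Nfun_le _ _ _ P n m X Y sg b beta A p q) => //; first exact: ltW.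
  by rewrite mul2n -addnn (leq_trans (leq_addr (Num.truncn x) p))// (leq_trans (leqnSn q)) ?leq_addr.
apply: moment_bound_le => //.
- by rewrite mul2n -addnn leq_add2r.
- by rewrite mulnS add2n ltnS ltnS leq_pmull.
have -> : n.+1%:R = expR x :> R by rewrite lnK// posrE.
by rewrite ler_expR.
Qed.
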